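(* There is a constant $c>0$ such that the following holds. Let $n\in\mathbb{N}$ and $\rho\in(0,1)$, and consider the $n\times n$ input-queued switch (described in the context) whose $n^2$ arrival streams are independent Bernoulli processes with common rate $\rho/n$, started empty. Then there exists a scheduling policy under which, for every time slot $\tau\in\mathbb{N}$, \[ \mathbb{E}\Big[\sum_{i,j=1}^n Q_{ij}(\tau)\Big]\le c\, n\,(1-\rho)^{-4/3}\log f,\qquad\text{where } f=\max\Big\{n,\frac{1}{1-\rho}\Big\}. \] The constant $c$ does not depend on $n$, $\rho$ or $\tau$.
   Context: An $n\times n$ input-queued switch consists of $n^2$ queues indexed by pairs $(i,j)$, $i,j\in[n]=\{1,\dots,n\}$, operating in discrete time slots $\tau\in\mathbb{N}$. Let $A_{ij}(\tau)$ be the cumulative number of arrivals to queue $(i,j)$ in slots $1,\dots,\tau$, with $A_{ij}(0)=0$; the increments $A_{ij}(\tau)-A_{ij}(\tau-1)$ are independent (over $i,j,\tau$) Bernoulli random variables with mean $\rho/n$. The set of feasible schedules is $\mathcal{S}=\{\sigma\in\{0,1\}^{n\times n}: \sum_{j'}\sigma_{ij'}\le 1\ \forall i,\ \sum_{i'}\sigma_{i'j}\le1\ \forall j\}$ (partial matchings). $Q_{ij}(\tau)$ is the size of queue $(i,j)$ at the beginning of slot $\tau$, with $Q_{ij}(1)=0$. In slot $\tau$ a scheduling policy observes the queue sizes (and the past history) and chooses $\sigma(\tau)\in\mathcal{S}$; then $Q_{ij}(\tau+1)=(Q_{ij}(\tau)-\sigma_{ij}(\tau))^+ + A_{ij}(\tau)-A_{ij}(\tau-1)$.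 A scheduling policy is any rule choosing $\sigma(\tau)$ based on the past history and current queue sizes (it may depend on the known parameters $n$ and $\rho$). *)

(* Defs.v *)
From mathcomp Require Import all_boot.
From Stdlib Require Import Reals.
Set Implicit Arguments. Unset Strict Implicit. Unset Printing Implicit Defensive.

Definition arr (n : nat) := {ffun 'I_n * 'I_n -> bool}.
Definition no_arr (n : nat) : arr n := [ffun => false].

Definition sched (n : nat) := 'I_n -> 'I_n -> bool.

Definition feasible (n : nat) (s : sched n) : Prop :=
  (forall i : 'I_n, \sum_(j < n) nat_of_bool (s i j) <= 1)%N /\
  (forall j : 'I_n, \sum_(i < n) nat_of_bool (s i j) <= 1)%N.

(* An (arrival) history: h s = arrival increments A(s)-A(s-1) in slot s >= 1.
   A policy chooses sigma(t) from the slot index and the history. *)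
Definition policy (n : nat) := nat -> (nat -> arr n) -> sched n.

(* Causality: sigma(t) only depends on the arrivals in slots s < t
   (the queue sizes and past schedules are functions of these). *)
Definition causal (n : nat) (pol : policy n) : Prop :=
  forall t h h', (forall s, (s < t)%N -> h s = h' s) -> pol t h = pol t h'.

Definition all_feasible (n : nat) (pol : policy n) : Prop :=
  forall t h, feasible (pol t h).

(* Q(t) for t >= 1: Q(1) = 0, Q(t+1) = (Q(t) - sigma(t))^+ + a(t).
   (nat subtraction is truncated, giving the positive part.) *)
Fixpoint qlen (n : nat) (pol : policy n) (h : nat -> arr n) (t : nat)
  : 'I_n -> 'I_n -> nat :=
  match t with
  | 0 => fun _ _ => 0%N
  | S t' =>
    match t' with
    | 0 => fun _ _ => 0%N
    | S _ => fun i j =>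
        (qlen pol h t' i j - nat_of_bool (pol t' h i j)
         + nat_of_bool (h t' (i, j)))%N
    end
  end.

Definition total_queue (n : nat) (pol : policy n) (h : nat -> arr n) (t : nat)
  : nat := (\sum_(i < n) \sum_(j < n) qlen pol h t i j)%N.

(* A finite history of m slots (slots 1..m), extended by "no arrivals". *)
Definition ext_hist (n m : nat) (g : {ffun 'I_m -> arr n}) : nat -> arr n :=
  fun s => match s with
           | 0 => no_arr n
           | S k => match insub k with Some k' => g k' | None => no_arr n end
           end.

Definition hist_prob (n m : nat) (rho : R) (g : {ffun 'I_m -> arr n}) : R :=
  foldr Rmult 1%R
    [seq (if g k ij then (rho / INR n)%R else (1 - rho / INR n)%R)
       | k <- enum 'I_m, ij <- enum [set: 'I_n * 'I_n]].

(* E[ sum_{i,j} Q_ij(tau) ] for tau >= 1: Q(tau) depends on slots 1..tau-1. *)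
Definition expected_total_queue (n : nat) (rho : R) (pol : policy n) (tau : nat)
  : R :=
  foldr Rplus 0%R
    [seq (hist_prob rho g * INR (total_queue pol (ext_hist g) tau))%R
       | g <- enum [set: {ffun 'I_(tau.-1) -> arr n}]].

(* Main.v *)
Require Import Defs.
From Stdlib Require Import FunctionalExtensionality ClassicalEpsilon Reals.
From mathcomp Require Import all_boot all_order all_algebra all_fingroup zify ring lra.
From mathcomp Require Import Rstruct Rstruct_topology.
From mathcomp Require Import reals sequences exp.
Set Implicit Arguments. Unset Strict Implicit. Unset Printing Implicit Defensive.
Import Order.TTheory GRing.Theory Num.Theory.

(** Time is cut into windows of [d] slots, and [r] consecutive windows form a batch.  The
    arrivals of a window are a random bipartite multigraph; with high probability it contains
    a [k]-factor with [k = rho d - O (sqrt (d L))], [L = log f], which is split into [k] perfect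
    matchings and served, without wasting any slot, during the next window.  The few remaining
    packets accumulate over a batch and are served, through an edge colouring, in the [d - k]
    free slots of the windows of the next batch.  With [d ~ L (1 - rho)^(-4/3)] and a batch of
    [~ L (1 - rho)^(-2)] slots, the packets waiting for their factor and the [r n sqrt (d L)]
    remainders both number [O (n L (1 - rho)^(-4/3))], while a batch overflows with a
    probability polynomially small in [f]; the overflow is controlled by an exponential
    Lyapunov function.  The [k]-factor exists as soon as every cut between [s] rows and [t]
    columns carries [k s t / n] edges, which is a Chernoff bound and a union bound. *)

(** * Factors of bipartite multigraphs *)

(** The slack of a port is 1 - rho per slot, so its arrivals stay below capacity with high
    probability only over about L (1 - rho)^(-2) slots; holding every packet for that long would
    cost n L (1 - rho)^(-2). Windows shorten the wait of most packets, but the fluctuations of the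
    cuts over d slots keep about n sqrt (d L) packets per window out of the factor. For a fixed
    batch length b, the two costs n d and n (b / d) sqrt (d L) balance when d^(3/2) = b L^(1/2),
    that is d of order L (1 - rho)^(-4/3): this is the origin of the exponent. Stability is decided
    port by port: a factor takes the same number of packets from every port, so the remainder of a
    batch is no less balanced than the batch itself, and the whole remainder can be treated as one
    scalar workload. *)

Definition cut n (M : 'I_n -> 'I_n -> nat) (S T : {set 'I_n}) : nat :=
  \sum_(i < n) \sum_(j < n) M i j * ((i \in S) && (j \in T)).

Definition regular n (k : nat) (M : 'I_n -> 'I_n -> nat) : Prop :=
  (forall i, \sum_(j < n) M i j = k) /\ (forall j, \sum_(i < n) M i j = k).

(* Ore's condition: every cut of the bipartite multigraph [M] carries the flow
   that a [k]-factor needs. *)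
Definition ore n (k : nat) (M : 'I_n -> 'I_n -> nat) : bool :=
  [forall S : {set 'I_n}, forall T : {set 'I_n}, k * (#|S| + #|T|) <= cut M S T + k * n].

Lemma oreP n k (M : 'I_n -> 'I_n -> nat) :
  reflect (forall S T : {set 'I_n}, k * (#|S| + #|T|) <= cut M S T + k * n) (ore k M).
Proof. exact: 'forall_forallP. Qed.

Definition drop_edge n (M : 'I_n -> 'I_n -> nat) (a b : 'I_n) : 'I_n -> 'I_n -> nat :=
  fun i j => M i j - ((i == a) && (j == b)).

Lemma sum_at n (F : 'I_n -> nat) a : \sum_(i < n) F i * (i == a) = F a.
Proof.
by rewrite (bigD1 a) //= eqxx muln1 big1 ?addn0 // => i /negbTE ->; rewrite muln0.
Qed.

Lemma sum2_at n (F : 'I_n -> 'I_n -> nat) a b :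
  \sum_(i < n) \sum_(j < n) F i j * ((i == a) && (j == b)) = F a b.
Proof.
under eq_bigr => i _ do under eq_bigr => j _ do rewrite -mulnb mulnCA mulnC.
under eq_bigr => i _ do rewrite -big_distrl /= sum_at.
exact: sum_at.
Qed.

Lemma cut_drop_edge n (M : 'I_n -> 'I_n -> nat) a b (S T : {set 'I_n}) : 0 < M a b ->
  cut (drop_edge M a b) S T + ((a \in S) && (b \in T)) = cut M S T.
Proof.
move=> Mab; rewrite /cut.
rewrite -[X in _ + X](sum2_at (fun i j => ((i \in S) && (j \in T)) : nat)).
rewrite -big_split; apply: eq_bigr => i _ /=; rewrite -big_split; apply: eq_bigr => j _ /=.
rewrite /drop_edge; case: (i =P a) => [->|_]; case: (j =P b) => [->|_] /=;
  rewrite ?muln0 ?muln1 ?subn0 ?addn0 //.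
by rewrite -mulSnr subn1 prednK.
Qed.

(** Rows are joined while columns are met: this is submodularity for the lattice in which the order
    on columns is reversed. It is checked edge by edge; what is lost are the edges from [S1] minus
    [S2] to [T1] minus [T2], and from [S2] minus [S1] to [T2] minus [T1]. *)
Lemma cut_uncross n (M : 'I_n -> 'I_n -> nat) (S1 T1 S2 T2 : {set 'I_n}) :
  cut M (S1 :|: S2) (T1 :&: T2) + cut M (S1 :&: S2) (T1 :|: T2)
    <= cut M S1 T1 + cut M S2 T2.
Proof.
rewrite /cut -!big_split /=; apply: leq_sum => i _; rewrite -!big_split /=.
apply: leq_sum => j _; rewrite -!mulnDr leq_mul2l; apply/orP; right.
by rewrite !inE; case: (i \in S1); case: (i \in S2); case: (j \in T1); case: (j \in T2).
Qed.

Lemma cut_tr n (M : 'I_n -> 'I_n -> nat) (S T : {set 'I_n}) :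
  cut (fun i j => M j i) S T = cut M T S.
Proof.
rewrite /cut exchange_big; apply: eq_bigr => i _; apply: eq_bigr => j _.
by rewrite andbC.
Qed.

Lemma ore_tr n k (M : 'I_n -> 'I_n -> nat) : ore k M -> ore k (fun i j => M j i).
Proof. by move/oreP=> H; apply/oreP => S T; rewrite cut_tr addnC H. Qed.

(** Together with Ore's condition, this minimality will force the multigraph to be a [k]-factor
    itself. *)
Definition edge_minimal n k (M : 'I_n -> 'I_n -> nat) : Prop :=
  forall a b, 0 < M a b -> ~~ ore k (drop_edge M a b).

Lemma cut_row n (M : 'I_n -> 'I_n -> nat) (S T : {set 'I_n}) i :
  i \in S -> (forall j, 0 < M i j -> j \in T) ->
  cut M S T = cut M (S :\ i) T + \sum_(j < n) M i j.
Proof.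
move=> iS supp; rewrite /cut (bigD1 i) //= addnC; congr (_ + _).
  rewrite [RHS](bigD1 i) //= [X in _ = X + _]big1 ?add0n => [|j _].
    by apply: eq_bigr => a ai; apply: eq_bigr => b _; rewrite !inE ai.
  by rewrite !inE eqxx muln0.
apply: eq_bigr => j _; rewrite iS /=; case: (posnP (M i j)) => [->//|Mij].
by rewrite supp ?muln1.
Qed.

Lemma orePn n k (M : 'I_n -> 'I_n -> nat) : ~~ ore k M ->
  exists S T : {set 'I_n}, cut M S T + k * n < k * (#|S| + #|T|).
Proof.
move=> /forallPn[S /forallPn[T]]; rewrite -ltnNge => lt; by exists S, T.
Qed.

(* Uncrossing: the tight cuts through row [i] are closed under (meet, join), so a maximal
   one contains the whole support of the row; removing [i] from it bounds the degree. *)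
Lemma edge_minimal_row n k (M : 'I_n -> 'I_n -> nat) (i : 'I_n) :
  ore k M -> edge_minimal k M -> \sum_(j < n) M i j = k.
Proof.
move=> /oreP HM mini; apply/eqP; rewrite eqn_leq; apply/andP; split; last first.
  have := HM [set i] setT; rewrite cards1 cardsT card_ord mulnDr leq_add2r muln1.
  rewrite (@cut_row _ _ _ _ i) ?inE // => [|j _]; last by rewrite inE.
  rewrite (_ : cut _ _ _ = 0) // /cut big1 // => a _; rewrite big1 // => b _.
  by rewrite !inE andNb muln0.
pose tight (ST : {set 'I_n} * {set 'I_n}) :=
  (i \in ST.1) && (k * (#|ST.1| + #|ST.2|) == cut M ST.1 ST.2 + k * n).
have tight_at j : 0 < M i j -> exists2 ST, tight ST & j \in ST.2.
  move=> Mij; have [S [T lt]] := orePn (mini i j Mij).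
  have le := HM S T; have := cut_drop_edge S T Mij.
  (* Dropping an edge lowers a cut by at most one, and only if the cut contains it; so the violated
     cut contains the edge and was tight before. *)
  have [iS|iS] := boolP (i \in S); have [jT|jT] := boolP (j \in T) => E;
    try by move: lt; rewrite -[cut _ _ _]addn0 E ltnNge le.
  exists (S, T) => //; apply/andP; split=> //; apply/eqP/anti_leq.
  by apply/andP; split; [exact: le | rewrite -E addn1 addSn; exact: lt].
rewrite leqNgt; apply/negP => lt.
have [j0 Mj0] : exists j0, 0 < M i j0.
  apply/existsP; rewrite -[[exists _, _]]negbK negb_exists; apply/negP => /forallP H.
  by rewrite big1 // in lt => j _; apply/eqP; rewrite -leqn0 leqNgt.
have [ST0 ST0t _] := tight_at j0 Mj0.
case: (@arg_maxnP _ ST0 tight (fun ST => #|ST.2|) ST0t) => [[S T]] /andP[iS /eqP ST] Tmax.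
have {}ST : k * (#|S| + #|T|) = cut M S T + k * n := ST.
have supp j : 0 < M i j -> j \in T.
  move=> Mij; apply: contraT => jT.
  have [[S1 T1] /andP[iS1 /eqP E] /= jT1] := tight_at j Mij.
  have E1 : k * (#|S1| + #|T1|) = cut M S1 T1 + k * n := E.
  have : tight (S :&: S1, T :|: T1).
    apply/andP; split; first by rewrite inE iS.
    apply/eqP; change (k * (#|S :&: S1| + #|T :|: T1|) = cut M (S :&: S1) (T :|: T1) + k * n).
    have := HM (S :&: S1) (T :|: T1); have := HM (S :|: S1) (T :&: T1).
    have := cut_uncross M S T S1 T1; have := cardsUI S S1; have := cardsUI T T1.
    unfold reverse_coercion in *; clear Tmax; nia.
  move/Tmax => /=; rewrite leqNgt => /negP[].
  by apply: proper_card; apply/properP; split; [exact: subsetUl | exists j; rewrite ?inE ?jT1 ?orbT].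
have cS : #|S| = #|S :\ i|.+1 by rewrite (cardsD1 i) iS.
move: ST; rewrite cS addSn mulnS (cut_row iS supp) => ST.
by have := leq_add (HM (S :\ i) T) lt; rewrite addnAC -ST addnS addnC ltnn.
Qed.

(** Edges are deleted as long as Ore's condition survives, by induction on their number. What
    remains is edge-minimal, hence regular: its rows directly, its columns by transposition. *)
Lemma ore_factor n k (M : 'I_n -> 'I_n -> nat) : ore k M ->
  exists2 K, regular k K & forall i j, K i j <= M i j.
Proof.
have [N] := ubnP (cut M setT setT); elim: N M => // N IH M; rewrite ltnS => leN HM.
case: (boolP [exists a, exists b, (0 < M a b) && ore k (drop_edge M a b)]).
  move=> /existsP[a /existsP[b /andP[Mab Hab]]].
  have := cut_drop_edge setT setT Mab; rewrite !inE addn1 => E.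
  have [|K regK leK] := IH _ _ Hab; first by rewrite E.
  exists K => // i j; apply: leq_trans (leK i j) _; exact: leq_subr.
move=> none; have mini : edge_minimal k M.
  move=> a b Mab; apply: contra none => Hab.
  by apply/existsP; exists a; apply/existsP; exists b; rewrite Mab.
exists M => //; split=> [i|j]; first exact: edge_minimal_row.
apply: (@edge_minimal_row _ _ (fun a b => M b a)); first exact: ore_tr.
move=> a b Mba; apply: contra (mini b a Mba) => /ore_tr /oreP H; apply/oreP => S T.
apply: leq_trans (H S T) _; rewrite leq_add2r /cut; apply: leq_sum => c _; apply: leq_sum => e _.
by rewrite /drop_edge andbC.
Qed.

(** * Perfect matchings in regular multigraphs and edge colouring *)

Lemma sum_row_split n (F : 'I_n -> nat) (T : {set 'I_n}) :
  \sum_(j < n) F j = \sum_(j < n) F j * (j \in T) + \sum_(j < n) F j * (j \in ~: T).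
Proof.
rewrite -big_split; apply: eq_bigr => j _; rewrite inE /=.
by case: (j \in T); rewrite ?muln1 ?muln0 ?addn0.
Qed.

(** At most (k + 1) (n - |T|) of the (k + 1) |S| edges leaving [S] end outside [T], so the cut
    carries at least (k + 1) (|S| + |T| - n) edges, which is more than enough for a 1-factor. *)
Lemma regular_ore1 n k (M : 'I_n -> 'I_n -> nat) : regular k.+1 M -> ore 1 M.
Proof.
move=> [rM cM]; apply/oreP => S T; rewrite !mul1n.
have E : cut M S T + cut M S (~: T) = k.+1 * #|S|.
  rewrite mulnC -sum_nat_const [in RHS]big_mkcond /= /cut -big_split.
  apply: eq_bigr => i _ /=; case: (i \in S); last by rewrite !big1 // => j _; rewrite muln0.
  by rewrite -(rM i) (sum_row_split _ T).
have le : cut M S (~: T) <= k.+1 * #|~: T|.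
  rewrite /cut exchange_big mulnC -sum_nat_const [leqRHS]big_mkcond /=.
  apply: leq_sum => j _; case: (j \in ~: T); last by rewrite big1 // => i _; rewrite andbF muln0.
  rewrite -(cM j); apply: leq_sum => i _; rewrite andbT; by case: (i \in S); rewrite ?muln1 ?muln0.
have := cardsC T; rewrite card_ord => cT; have := max_card (mem S); rewrite card_ord; unfold reverse_coercion in *; nia.
Qed.

Lemma regular1_perm n (K : 'I_n -> 'I_n -> nat) : regular 1 K ->
  exists p : 'S_n, forall i j, K i j = (p i == j).
Proof.
move=> [rK cK].
have ex i : exists j, 0 < K i j.
  apply/existsP; rewrite -[[exists _, _]]negbK negb_exists; apply/negP => /forallP H.
  have := rK i; rewrite big1 // => j _; apply/eqP; by rewrite -leqn0 leqNgt.
pose f i := xchoose (ex i); have fP i : 0 < K i (f i) := xchooseP (ex i).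
have f_inj : injective f.
  move=> a b E; apply/eqP; apply: contraT => ab; have := cK (f a).
  rewrite (bigD1 a) //= (bigD1 b) 1?eq_sym //=.
  have := fP a; have := fP b; rewrite E; lia.
exists (perm f_inj) => i j; rewrite permE; have := rK i; rewrite (bigD1 (f i)) //=.
case: eqP => [<-|/eqP ne]; first by have := fP i; lia.
by rewrite (bigD1 j) 1?eq_sym //=; have := fP i; lia.
Qed.

(** König's theorem: a perfect matching is peeled off, and what remains is regular of degree one
    less. *)
Lemma regular_decomposition n k (K : 'I_n -> 'I_n -> nat) : regular k K ->
  exists P : nat -> 'S_n, forall i j, K i j = \sum_(v < k) (P v i == j).
Proof.
elim: k K => [|k IH] K regK.
  exists (fun=> 1%g) => i j; rewrite big_ord0; apply/eqP.
  by have := regK.1 i; move/eqP; rewrite sum_nat_eq0 => /forallP /(_ j).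
have [K1 regK1 leK1] := ore_factor (regular_ore1 regK).
have [p pE] := regular1_perm regK1.
have [|P PE] := IH (fun i j => K i j - K1 i j).
  by split=> [i|j]; rewrite sumnB // ?regK.1 ?regK.2 ?regK1.1 ?regK1.2 subn1.
exists (fun v => if v is u.+1 then P u else p) => i j.
by rewrite big_ord_recl /= -pE -PE subnKC.
Qed.

(** Row sums and column sums have the same total, so a deficient row comes with a deficient column,
    and an edge can be added between them. The induction is on the number of missing edges. *)
Lemma regular_extension n D (M : 'I_n -> 'I_n -> nat) :
  (forall i, \sum_(j < n) M i j <= D) -> (forall j, \sum_(i < n) M i j <= D) ->
  exists2 K, regular D K & forall i j, M i j <= K i j.
Proof.
have [N] := ubnP (n * D - \sum_(i < n) \sum_(j < n) M i j).
elim: N M => // N IH M; rewrite ltnS => leN rM cM.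
have tot (F : 'I_n -> nat) : (forall i, F i <= D) ->
    (exists2 a, F a < D & \sum_(i < n) F i < n * D) \/ (forall i, F i = D).
  move=> leF; case: (boolP [exists a, F a < D]) => [/existsP[a ltF]|].
    left; exists a => //; rewrite -[n in n * D]card_ord -sum_nat_const.
    rewrite (bigD1 a) //= [ltnRHS](bigD1 a) //= -addSn leq_add //; exact: leq_sum.
  move=> /existsPn H; right=> i; apply/eqP; rewrite eqn_leq leF leqNgt; exact: H.
case: (tot _ rM) => [[a lta ltN]|rE]; case: (tot _ cM) => [[b ltb ltN']|cE].
- pose M' i j := M i j + ((i == a) && (j == b)).
  have rE i : \sum_(j < n) M' i j = \sum_(j < n) M i j + (i == a).
    rewrite big_split /=; congr (_ + _); under eq_bigr => j _ do rewrite -mulnb.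
    exact: (sum_at (fun=> (i == a) : nat)).
  have cE j : \sum_(i < n) M' i j = \sum_(i < n) M i j + (j == b).
    rewrite big_split /=; congr (_ + _); under eq_bigr => i _ do rewrite -mulnb mulnC.
    exact: (sum_at (fun=> (j == b) : nat)).
  have [| | |K regK leK] := IH M'.
  + under eq_bigr => i _ do rewrite rE.
    rewrite big_split /=; have -> : \sum_(i < n) (i == a) = 1.
      by rewrite -(sum_at (fun=> 1) a); apply: eq_bigr => i _; rewrite mul1n.
    move: leN ltN => /=; lia.
  + by move=> i; rewrite rE; case: eqP => [->|_]; rewrite ?addn1 ?addn0.
  + by move=> j; rewrite cE; case: eqP => [->|_]; rewrite ?addn1 ?addn0.
  exists K => // i j; apply: leq_trans (leK i j); exact: leq_addr.
- move: ltN; rewrite exchange_big /= (eq_bigr (fun=> D)) // sum_nat_const card_ord.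
  by rewrite ltnn.
- move: ltN'; rewrite exchange_big /= (eq_bigr (fun=> D)) // sum_nat_const card_ord.
  by rewrite ltnn.
by exists M.
Qed.

Lemma matching_cover n D (M : 'I_n -> 'I_n -> nat) :
  (forall i, \sum_(j < n) M i j <= D) -> (forall j, \sum_(i < n) M i j <= D) ->
  exists P : nat -> 'S_n, forall i j, M i j <= \sum_(v < D) (P v i == j).
Proof.
move=> rM cM; have [K /regular_decomposition[P PE] leK] := regular_extension rM cM.
by exists P => i j; rewrite -PE.
Qed.

(** * The batching policy *)

Definition total n (M : 'I_n -> 'I_n -> nat) : nat := \sum_(i < n) \sum_(j < n) M i j.

Definition degree n (M : 'I_n -> 'I_n -> nat) : nat :=
  maxn (\max_(i < n) \sum_(j < n) M i j) (\max_(j < n) \sum_(i < n) M i j).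

Lemma degree_leqP n (M : 'I_n -> 'I_n -> nat) D :
  reflect ((forall i, \sum_(j < n) M i j <= D) /\ (forall j, \sum_(i < n) M i j <= D))
          (degree M <= D).
Proof.
rewrite geq_max; apply: (iffP andP) => [[/bigmax_leqP rM /bigmax_leqP cM]|[rM cM]].
  by split=> i; [exact: rM | exact: cM].
by split; apply/bigmax_leqP => x _.
Qed.

Lemma row_le_degree n (M : 'I_n -> 'I_n -> nat) i : \sum_(j < n) M i j <= degree M.
Proof. by have /degree_leqP[+ _] := leqnn (degree M). Qed.

Lemma col_le_degree n (M : 'I_n -> 'I_n -> nat) j : \sum_(i < n) M i j <= degree M.
Proof. by have /degree_leqP[_ +] := leqnn (degree M). Qed.

Lemma total_le_degree n (M : 'I_n -> 'I_n -> nat) : total M <= n * degree M.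
Proof.
rewrite -[n in n * _]card_ord -sum_nat_const; apply: leq_sum => i _; exact: row_le_degree.
Qed.

Definition served n (P : nat -> 'S_n) (u : nat) : 'I_n -> 'I_n -> nat :=
  fun i j => \sum_(v < u) (P v i == j).

Lemma sum_perm_row n (p : 'S_n) i : \sum_(j < n) (p i == j) = 1.
Proof.
rewrite -(sum_at (fun=> 1) (p i)); apply: eq_bigr => j _; by rewrite mul1n eq_sym.
Qed.

Lemma sum_perm_col n (p : 'S_n) j : \sum_(i < n) (p i == j) = 1.
Proof.
rewrite -(sum_at (fun=> 1) (p^-1%g j)); apply: eq_bigr => i _; rewrite mul1n.
by rewrite (canF_eq (permK p)) eq_sym (can2_eq (permKV p) (permK p)) eq_sym.
Qed.

Lemma regular_served n (P : nat -> 'S_n) u : regular u (served P u).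
Proof.
by split=> x; rewrite exchange_big /=; under eq_bigr => v _ do
  rewrite (sum_perm_row, sum_perm_col); rewrite sum_nat_const card_ord muln1.
Qed.

Lemma total_served n (P : nat -> 'S_n) u : total (served P u) = n * u.
Proof.
rewrite /total; under eq_bigr => i _ do rewrite (regular_served P u).1.
by rewrite sum_nat_const card_ord.
Qed.

Lemma servedD n (P : nat -> 'S_n) u v i j :
  served P (u + v) i j = served P u i j + \sum_(w < v) (P (u + w) i == j).
Proof. by rewrite /served big_split_ord. Qed.

Lemma feasible_perm n (p : 'S_n) : feasible (fun i j => p i == j).
Proof. by split=> x; rewrite (sum_perm_row, sum_perm_col). Qed.

(** Choice yields matchings for every multigraph, so the policy is defined on all histories. They
    use only edges of [M] when [ore] holds; otherwise they may be arbitrary, though still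
    feasible. *)
Definition factor n k (M : 'I_n -> 'I_n -> nat) : nat -> 'S_n :=
  epsilon (inhabits (fun=> 1%g)) (fun P => forall i j, served P k i j <= M i j).

Lemma factorP n k (M : 'I_n -> 'I_n -> nat) :
  ore k M -> forall i j, served (factor k M) k i j <= M i j.
Proof.
move=> /ore_factor[K /regular_decomposition[P PE] leK].
apply: (epsilon_spec (inhabits (fun=> 1%g))
  (fun P : nat -> 'S_n => forall i j, served P k i j <= M i j)).
by exists P => i j; rewrite /served -PE.
Qed.

Definition cover n (M : 'I_n -> 'I_n -> nat) : nat -> 'S_n :=
  epsilon (inhabits (fun=> 1%g)) (fun P => forall i j, M i j <= served P (degree M) i j).

Lemma coverP n (M : 'I_n -> 'I_n -> nat) i j : M i j <= served (cover M) (degree M) i j.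
Proof.
move: i j; apply: (epsilon_spec (inhabits (fun=> 1%g))
  (fun P : nat -> 'S_n => forall i j, M i j <= served P (degree M) i j)).
by apply: matching_cover; [exact: row_le_degree | exact: col_le_degree].
Qed.

Definition residual n k (M : 'I_n -> 'I_n -> nat) : 'I_n -> 'I_n -> nat :=
  fun i j => M i j - served (factor k M) k i j.

Lemma total_residual_le n k (M : 'I_n -> 'I_n -> nat) : total (residual k M) <= total M.
Proof. by apply: leq_sum => i _; apply: leq_sum => j _; exact: leq_subr. Qed.

Lemma total_residual n k (M : 'I_n -> 'I_n -> nat) :
  ore k M -> total (residual k M) + n * k = total M.
Proof.
move=> /factorP le; rewrite -(total_served (factor k M)) /total -big_split.
apply: eq_bigr => i _; rewrite -big_split; apply: eq_bigr => j _ /=; exact: subnK.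
Qed.

Definition after_cover n (M : 'I_n -> 'I_n -> nat) (u : nat) : 'I_n -> 'I_n -> nat :=
  fun i j => M i j - served (cover M) u i j.

(** What is left after [u] matchings of the colouring is covered by the remaining ones, each of
    which contributes one to every row and column. *)
Lemma degree_after_cover n (M : 'I_n -> 'I_n -> nat) u :
  degree (after_cover M u) <= degree M - u.
Proof.
case: (leqP (degree M) u) => [le|/ltnW le]; last first.
  have E := subnKC le; have H i j :
      after_cover M u i j <= \sum_(w < degree M - u) (cover M (u + w) i == j).
    by rewrite leq_subLR -servedD E coverP.
  have [rS cS] := regular_served (fun w => cover M (u + w)) (degree M - u).
  by apply/degree_leqP; split=> x; [rewrite -[leqRHS](rS x) | rewrite -[leqRHS](cS x)]; apply: leq_sum => y _; exact: H.
have H i j : after_cover M u i j = 0.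
  apply/eqP; rewrite subn_eq0; apply: leq_trans (coverP M i j) _.
  by rewrite -(subnKC le) servedD leq_addr.
by apply/degree_leqP; split=> x; rewrite big1.
Qed.

Lemma degreeD n (M N : 'I_n -> 'I_n -> nat) :
  degree (fun i j => M i j + N i j) <= degree M + degree N.
Proof.
by apply/degree_leqP; split=> x; rewrite big_split leq_add ?row_le_degree ?col_le_degree.
Qed.

Lemma totalD n (M N : 'I_n -> 'I_n -> nat) :
  total (fun i j => M i j + N i j) = total M + total N.
Proof. by rewrite /total -big_split; apply: eq_bigr => i _; rewrite big_split. Qed.

(** The index [s] stands for slot s + 1: the half-open range from [a] to [b] covers the slots a + 1,
    ..., b, and [h 0] is never read. *)
Definition arrivals n (h : nat -> arr n) (a b : nat) : 'I_n -> 'I_n -> nat :=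
  fun i j => \sum_(a <= s < b) h s.+1 (i, j).

Lemma arrivals_cat n (h : nat -> arr n) a b c i j : a <= b -> b <= c ->
  arrivals h a c i j = arrivals h a b i j + arrivals h b c i j.
Proof. exact: big_cat_nat. Qed.

Lemma eq_arrivals n (h h' : nat -> arr n) a b :
  (forall s, s <= b -> h s = h' s) -> arrivals h a b = arrivals h' a b.
Proof.
move=> E; apply: functional_extensionality => i; apply: functional_extensionality => j.
by rewrite /arrivals !big_nat; apply: eq_bigr => s /andP[_ lt]; rewrite E.
Qed.

Lemma degree_arrivals n (h : nat -> arr n) a b : degree (arrivals h a b) <= n * (b - a).
Proof.
by apply/degree_leqP; split=> x; rewrite -[n in n * _]card_ord -sum_nat_const;
  apply: leq_sum => y _; rewrite -[b - a]muln1 -sum_nat_const_nat; apply: leq_sum => s _;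
  exact: leq_b1.
Qed.

(** * Sample-path analysis of the batching policy *)

Section Batching.
Variables n d r k : nat.

Definition window (h : nat -> arr n) (w : nat) : 'I_n -> 'I_n -> nat :=
  arrivals h (w * d) (w.+1 * d).

Definition leftover (h : nat -> arr n) (m l : nat) : 'I_n -> 'I_n -> nat :=
  fun i j => \sum_(m * r <= w < m * r + l) residual k (window h w) i j.

(** Virtual queues computed from the arrivals alone: the residuals of the batches before [m], less
    the free slots already granted to them. The policy colours these instead of the true queues,
    which are only bounded by them. *)
Fixpoint backlog (h : nat -> arr n) (m : nat) : 'I_n -> 'I_n -> nat :=
  if m is m'.+1 then
    fun i j => after_cover (backlog h m') (r * (d - k)) i j + leftover h m' r i j
  else fun _ _ => 0.

(* In slot [t = s + 1] with [s = w d + u], the [k]-factor of the arrivals of window [w - 1]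
   is served if [u < k], and the backlog of the batch of window [w - 1] otherwise. *)
Definition batch_policy : policy n := fun t h =>
  let s := t.-1 in let w := (s %/ d).-1 in let u := s %% d in
  let p := if s < d then 1%g else
           if u < k then factor k (window h w) u
           else cover (backlog h (w %/ r)) ((w %% r) * (d - k) + (u - k)) in
  fun i j => p i == j.

Lemma batch_policy_feasible : all_feasible batch_policy.
Proof. by move=> t h; exact: feasible_perm. Qed.

Lemma eq_window h h' w : (forall s, s <= w.+1 * d -> h s = h' s) -> window h w = window h' w.
Proof. exact: eq_arrivals. Qed.

Lemma eq_leftover h h' m l : (forall s, s <= (m * r + l) * d -> h s = h' s) ->
  leftover h m l = leftover h' m l.
Proof.
move=> E; apply: functional_extensionality => i; apply: functional_extensionality => j.
rewrite /leftover !big_nat; apply: eq_bigr => w /andP[_ lt]; rewrite (@eq_window h h') // => s le.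
by apply: E; apply: leq_trans le _; rewrite leq_mul2r lt orbT.
Qed.

Lemma eq_backlog h h' m : (forall s, s <= m * r * d -> h s = h' s) -> backlog h m = backlog h' m.
Proof.
elim: m => //= m IH E; rewrite IH => [|s le]; last first.
  by apply: E; apply: leq_trans le _; rewrite mulSn mulnDl leq_addl.
by rewrite (@eq_leftover h h') // => s le; apply: E; rewrite mulSn addnC.
Qed.

Hypotheses (d_gt0 : 0 < d) (r_gt0 : 0 < r).

Lemma batch_policy_causal : causal batch_policy.
Proof.
move=> t h h' E; rewrite /batch_policy; case: ltnP => // le; set w := (t.-1 %/ d).-1.
have wE : w.+1 = t.-1 %/ d by rewrite prednK // divn_gt0.
have ltt : w.+1 * d < t.
  by rewrite wE; apply: leq_ltn_trans (leq_trunc_div _ _) _; lia.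
rewrite (@eq_window h h'); last by move=> s les; apply: E; lia.
rewrite (@eq_backlog h h') // => s les; apply: E; apply: leq_ltn_trans les _.
apply: leq_ltn_trans ltt; rewrite leq_mul2r; apply/orP; right.
by apply: leqW; exact: leq_trunc_div.
Qed.

Lemma qlenS (pol : policy n) h s i j :
  qlen pol h s.+2 i j = qlen pol h s.+1 i j - pol s.+1 h i j + h s.+1 (i, j).
Proof. by []. Qed.

(** Charging all the service to the packets present at the start, and none to those arriving
    meanwhile, can only overestimate the queue. *)
Lemma qlen_serve (pol : policy n) h s u i j x : qlen pol h s.+1 i j <= x ->
  qlen pol h (s + u).+1 i j <=
    x - \sum_(v < u) pol (s + v).+1 h i j + arrivals h s (s + u) i j.
Proof.
move=> le; elim: u => [|u IH].
  by rewrite addn0 big_ord0 subn0 /arrivals big_geq // addn0.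
rewrite addnS qlenS (@arrivals_cat _ _ s (s + u)) ?leq_addr // [X in _ + (_ + X)]big_nat1.
have step q S A b a : q <= x - S + A -> q - b + a <= x - (S + b) + (A + a) by lia.
by rewrite big_ord_recr; exact: step.
Qed.

Lemma batch_policy_slot h w u i j : u < d ->
  batch_policy (w.+1 * d + u).+1 h i j =
  (((if u < k then factor k (window h w) u
     else cover (backlog h (w %/ r)) ((w %% r) * (d - k) + (u - k))) i == j)).
Proof.
move=> ud; rewrite /batch_policy /= mulSn -addnA ltnNge leq_addr /=.
by rewrite addnA -mulSn divnMDl // divn_small // addn0 modnMDl modn_small.
Qed.

Hypothesis (kd : k <= d).

Lemma batch_policy_served h w i j :
  \sum_(u < d) batch_policy (w.+1 * d + u).+1 h i j =
  served (factor k (window h w)) k i j +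
  \sum_(v < d - k) (cover (backlog h (w %/ r)) ((w %% r) * (d - k) + v) i == j).
Proof.
pose F u : nat := batch_policy (w.+1 * d + u).+1 h i j.
rewrite -[LHS]/(\sum_(u < d) F u).
have -> : \sum_(u < d) F u = \sum_(u < k + (d - k)) F u by rewrite subnKC.
rewrite big_split_ord /=; congr (_ + _).
  apply: eq_bigr => u _; rewrite /F batch_policy_slot; last exact: leq_trans (ltn_ord u) kd.
  by rewrite ltn_ord.
apply: eq_bigr => u _; rewrite /F batch_policy_slot; last first.
  by rewrite -[ltnRHS](subnKC kd) ltn_add2l.
by rewrite ltnNge leq_addr /= addKn.
Qed.

(** Separate accounts for the service of the factor and that of the backlog bound the queue from
    above: each truncation loses only service that the other account could have used. *)
Lemma sub_served_le (W Wk L B b : nat) : W + L + B - (Wk + b) <= (W - Wk) + L + (B - b).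
Proof. lia. Qed.

Lemma backlogS h m i j :
  backlog h m.+1 i j = after_cover (backlog h m) (r * (d - k)) i j + leftover h m r i j.
Proof. by []. Qed.

(** Invariant at the ends of windows: a queue consists of the window still awaiting its factor, the
    residuals of the current batch, and what remains of earlier batches. At l = r the last two terms
    add up to the backlog of the next batch, which starts the next round of the induction. *)
Lemma qlen_window h m l i j : l <= r ->
  qlen batch_policy h ((m * r + l).+1 * d).+1 i j <=
  window h (m * r + l) i j + leftover h m l i j +
  after_cover (backlog h m) (l * (d - k)) i j.
Proof.
have step m' l' : l' < r ->
    qlen batch_policy h ((m' * r + l').+1 * d).+1 i j <=
      window h (m' * r + l') i j + leftover h m' l' i j +
      after_cover (backlog h m') (l' * (d - k)) i j ->
    qlen batch_policy h ((m' * r + l'.+1).+1 * d).+1 i j <=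
      window h (m' * r + l'.+1) i j + leftover h m' l'.+1 i j +
      after_cover (backlog h m') (l'.+1 * (d - k)) i j.
  move=> lt /(@qlen_serve _ h _ d); rewrite batch_policy_served -mulSnr addnS => le.
  apply: leq_trans le _; rewrite [leqLHS]addnC -[leqRHS]addnA; apply: leq_add => //.
  have -> : (m' * r + l') %/ r = m' by rewrite divnMDl // divn_small // addn0.
  have -> : (m' * r + l') %% r = l' by rewrite modnMDl modn_small.
  apply: leq_trans (sub_served_le _ _ _ _ _) _.
  rewrite /leftover addnS big_nat_recr ?leq_addr //= -/(leftover h m' l' i j).
  rewrite /after_cover mulSnr servedD subnDA /residual.
  by rewrite [X in X + _ <= _]addnC.
elim: m l => [|m IHm] l.
  elim: l => [_|l IHl lt]; last by apply: step => //; apply: IHl; exact: ltnW.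
  have le0 : qlen batch_policy h 1 i j <= 0 by [].
  have := @qlen_serve _ h 0 d _ _ _ le0; rewrite add0n sub0n add0n /window !mul0n mul1n => le.
  by rewrite -addnA; apply: leq_trans le _; exact: leq_addr.
elim: l => [_|l IHl lt]; last by apply: step => //; apply: IHl; exact: ltnW.
have := IHm r (leqnn r); rewrite -mulSnr addn0 => le; apply: leq_trans le _.
rewrite -!addnA leq_add2l [leqRHS](_ : _ = backlog h m.+1 i j); first by rewrite backlogS addnC.
rewrite /leftover addn0 big_geq // /after_cover mul0n /served big_ord0 subn0; exact: add0n.
Qed.

Lemma total_mono (M N : 'I_n -> 'I_n -> nat) : (forall i j, M i j <= N i j) -> total M <= total N.
Proof. by move=> le; apply: leq_sum => i _; apply: leq_sum => j _. Qed.

Lemma total_queue_window h m l u : l < r ->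
  total_queue batch_policy h ((m * r + l).+1 * d + u).+1 <=
  total (window h (m * r + l)) + total (leftover h m l) + total (backlog h m) +
  total (arrivals h ((m * r + l).+1 * d) ((m * r + l).+1 * d + u)).
Proof.
move=> lt; rewrite -!totalD; apply: total_mono => i j.
have := @qlen_window h m l i j (ltnW lt) => /(@qlen_serve _ h _ u) le; apply: leq_trans le _.
rewrite leq_add2r; apply: leq_trans (leq_subr _ _) _; rewrite leq_add2l; exact: leq_subr.
Qed.

Lemma total_queue_start h s : total_queue batch_policy h s.+1 <= total (arrivals h 0 s).
Proof.
apply: total_mono => i j; have le0 : qlen batch_policy h 1 i j <= 0 by [].
by have := @qlen_serve _ h 0 s _ _ _ le0.
Qed.

(** The part of the degree of the backlog that the free slots of one batch cannot clear. It obeys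
    the Lindley recursion [overflowS] of a single-server queue whose work is the degree of the
    leftovers, which reduces the n^2 queues to one scalar. *)
Definition overflow h m : nat := degree (backlog h m) - r * (d - k).

Lemma total_backlogS h m : total (backlog h m.+1) <= n * overflow h m + total (leftover h m r).
Proof.
rewrite totalD leq_add2r; apply: leq_trans (total_le_degree _) _.
by rewrite leq_mul2l degree_after_cover orbT.
Qed.

Lemma overflow0 h : overflow h 0 = 0.
Proof.
apply/eqP; rewrite subn_eq0; apply: leq_trans (leq0n _).
by apply/degree_leqP; split=> x; rewrite big1.
Qed.

Lemma overflowS h m : overflow h m.+1 <= overflow h m + degree (leftover h m r) - r * (d - k).
Proof.
apply: leq_sub2r; apply: leq_trans (degreeD _ _) _.
by rewrite leq_add2r degree_after_cover.
Qed.

Lemma arrivals_windows h w l i j :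
  arrivals h (w * d) ((w + l) * d) i j = \sum_(w <= v < w + l) window h v i j.
Proof.
elim: l => [|l IH]; first by rewrite addn0 /arrivals !big_geq.
rewrite addnS big_nat_recr ?leq_addr //= -IH /window.
by rewrite (@arrivals_cat _ _ _ ((w + l) * d)) ?leq_mul2r ?leq_addr ?leqnSn ?orbT.
Qed.

Lemma total_leftover h m l :
  total (leftover h m l) = \sum_(m * r <= w < m * r + l) total (residual k (window h w)).
Proof.
rewrite /total [RHS]exchange_big; apply: eq_bigr => i _; exact: exchange_big.
Qed.

Lemma leftover_le_arrivals h m i j :
  leftover h m r i j <= arrivals h (m * r * d) (m.+1 * r * d) i j.
Proof.
rewrite mulSnr arrivals_windows; apply: leq_sum => w _; exact: leq_subr.
Qed.

Lemma degree_leftover h m : degree (leftover h m r) <= n * (r * d).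
Proof.
have -> : r * d = m.+1 * r * d - m * r * d by rewrite mulSnr mulnDl addKn.
apply: leq_trans (degree_arrivals _ _ _); apply/degree_leqP; split=> x.
  apply: leq_trans (row_le_degree _ x); apply: leq_sum => y _; exact: leftover_le_arrivals.
apply: leq_trans (col_le_degree _ x); apply: leq_sum => y _; exact: leftover_le_arrivals.
Qed.

Lemma leftover_ore h m i j : (forall w, m * r <= w < m * r + r -> ore k (window h w)) ->
  leftover h m r i j + \sum_(m * r <= w < m * r + r) served (factor k (window h w)) k i j
  = arrivals h (m * r * d) (m.+1 * r * d) i j.
Proof.
move=> Hore; rewrite [m.+1 * r]mulSnr arrivals_windows -big_split !big_nat.
by apply: eq_bigr => w wr /=; rewrite subnK // factorP // Hore.
Qed.

(** When every window has its factor, the factors of the batch remove exactly r k packets at each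
    port, so the leftovers inherit the degree bound of the batch, lowered by r k. *)
Lemma degree_leftover_ore h m D : r * k <= D ->
  (forall w, m * r <= w < m * r + r -> ore k (window h w)) ->
  degree (arrivals h (m * r * d) (m.+1 * r * d)) <= D ->
  degree (leftover h m r) + r * k <= D.
Proof.
move=> rkD Hore /degree_leqP[rA cA].
have rS := fun w => (regular_served (factor k (window h w)) k).1.
have cS := fun w => (regular_served (factor k (window h w)) k).2.
have cst : \sum_(m * r <= w < m * r + r) k = r * k by rewrite sum_nat_const_nat addKn.
suff : degree (leftover h m r) <= D - r * k by lia.
apply/degree_leqP; split=> x.
  have := rA x; under eq_bigr => y _ do rewrite -leftover_ore //.
  rewrite big_split /= [X in _ + X <= _]exchange_big /= [X in _ + X <= _](eq_bigr (fun=> k) (fun w _ => rS w x)).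
  by rewrite cst; lia.
have := cA x; under eq_bigr => y _ do rewrite -leftover_ore //.
rewrite big_split /= [X in _ + X <= _]exchange_big /= [X in _ + X <= _](eq_bigr (fun=> k) (fun w _ => cS w x)).
by rewrite cst; lia.
Qed.

Lemma eq_overflow h h' m : (forall s, s <= m * r * d -> h s = h' s) -> overflow h m = overflow h' m.
Proof. by move=> E; rewrite /overflow (eq_backlog E). Qed.
End Batching.

(** * Expectation over arrival histories *)

Local Open Scope ring_scope.

Definition upd n (h : nat -> arr n) (s : nat) (x : arr n) : nat -> arr n :=
  fun t => if t == s then x else h t.

Definition depends_upto (T : Type) n (s : nat) (phi : (nat -> arr n) -> T) : Prop :=
  forall h h', (forall t, (t <= s)%N -> h t = h' t) -> phi h = phi h'.

Section Expectation.
Variables (R : realFieldType) (n : nat) (p : R).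
Hypothesis (p01 : 0 <= p <= 1).

Definition slot_weight (x : arr n) : R := \prod_ij (if x ij then p else 1 - p).

(* The conditional expectation of [phi] given the slots up to [s], the slots
   [s + 1, ..., s + l] being resampled and the later ones kept as in [h]. *)
Fixpoint expect (s l : nat) (phi : (nat -> arr n) -> R) (h : nat -> arr n) : R :=
  if l is l'.+1
  then \sum_x slot_weight x * expect s.+1 l' phi (upd h s.+1 x)
  else phi h.

Lemma sum_slot_weight_prod (F : 'I_n * 'I_n -> bool -> R) :
  \sum_x slot_weight x * (\prod_ij F ij (x ij)) =
  \prod_ij (p * F ij true + (1 - p) * F ij false).
Proof.
transitivity (\sum_(x : arr n) \prod_ij ((if x ij then p else 1 - p) * F ij (x ij))).
  by apply: eq_bigr => x _; rewrite [RHS]big_split.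
under [RHS]eq_bigr => ij _.
  rewrite (_ : _ + _ = \sum_(b : bool) (if b then p else 1 - p) * F ij b); last first.
    by rewrite big_bool.
  over.
by rewrite bigA_distr_bigA.
Qed.

Lemma sum_slot_weight : \sum_x slot_weight x = 1.
Proof.
transitivity (\prod_(ij : 'I_n * 'I_n) (p * 1 + (1 - p) * 1)); last first.
  by apply: big1 => ij _; ring.
rewrite -(sum_slot_weight_prod (fun _ _ => 1)); apply: eq_bigr => x _.
by rewrite big1 ?mulr1.
Qed.

Lemma slot_weight_ge0 x : 0 <= slot_weight x.
Proof. by apply: prodr_ge0 => ij _; case: (x ij); case/andP: p01 => *; lra. Qed.

Lemma expect_split s l1 l2 phi h :
  expect s (l1 + l2) phi h = expect s l1 (expect (s + l1) l2 phi) h.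
Proof.
elim: l1 s h => [|l1 IH] s h; first by rewrite addn0.
by rewrite addSn /=; apply: eq_bigr => x _; rewrite IH addSnnS.
Qed.

Lemma le_expect s l phi psi h :
  (forall h, phi h <= psi h) -> expect s l phi h <= expect s l psi h.
Proof.
move=> le; elim: l s h => [|l IH] s h //=.
by apply: ler_sum => x _; rewrite ler_wpM2l ?slot_weight_ge0.
Qed.

Lemma eq_expect s l phi psi h : phi =1 psi -> expect s l phi h = expect s l psi h.
Proof. by move=> E; elim: l s h => [|l IH] s h //=; apply: eq_bigr => x _; rewrite IH. Qed.

Lemma expectD s l phi psi h :
  expect s l (fun h => phi h + psi h) h = expect s l phi h + expect s l psi h.
Proof.
elim: l s h => [|l IH] s h //=; rewrite -big_split /=.
by apply: eq_bigr => x _; rewrite IH mulrDr.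
Qed.

Lemma expectZ s l c phi h : expect s l (fun h => c * phi h) h = c * expect s l phi h.
Proof.
elim: l s h => [|l IH] s h //=; rewrite big_distrr /=.
by apply: eq_bigr => x _; rewrite IH mulrCA.
Qed.

Lemma expect_cst s l c h : expect s l (fun=> c) h = c.
Proof.
elim: l s h => [|l IH] s h //=; under eq_bigr => x _ do rewrite IH.
by rewrite -big_distrl /= sum_slot_weight mul1r.
Qed.

Lemma expect_sum (I : Type) (r : seq I) (P : pred I) (phi : I -> (nat -> arr n) -> R) s l h :
  expect s l (fun h => \sum_(i <- r | P i) phi i h) h =
  \sum_(i <- r | P i) expect s l (phi i) h.
Proof.
elim: l s h => [|l IH] s h //=; rewrite exchange_big /=.
by apply: eq_bigr => x _; rewrite IH big_distrr.
Qed.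

Lemma depends_upd (T : Type) s t (phi : (nat -> arr n) -> T) h x :
  depends_upto s phi -> (s < t)%N -> phi (upd h t x) = phi h.
Proof. by move=> dep lt; apply: dep => u le; rewrite /upd; case: eqP => // E; move: lt; rewrite -E ltnNge le. Qed.

Lemma expect_depends T s l phi h : depends_upto T phi -> (T <= s)%N -> expect s l phi h = phi h.
Proof.
move=> dep; elim: l s h => [|l IH] s h //= le.
under eq_bigr => x _ do rewrite IH ?leqW // (depends_upd _ _ dep) ?ltnS //.
by rewrite -big_distrl /= sum_slot_weight mul1r.
Qed.

Lemma expect_prefix T s l phi h : depends_upto T phi -> (s <= T <= s + l)%N ->
  expect s l phi h = expect s (T - s) phi h.
Proof.
move=> dep /andP[sT Tl]; have -> : l = (T - s + (s + l - T))%N by lia.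
by rewrite expect_split subnKC //; apply: eq_expect => h'; rewrite (expect_depends _ _ dep).
Qed.

(** A bound uniform in the conditioning history survives averaging over the earlier slots, and the
    slots after a + l integrate out. Estimates for one window or batch are brought to a longer
    horizon in this way. *)
Lemma expect_le_window a l s L phi c h : depends_upto (a + l) phi ->
  (forall h, expect a l phi h <= c) -> (s <= a)%N -> (a + l <= s + L)%N ->
  expect s L phi h <= c.
Proof.
move=> dep le sa alL; rewrite (@expect_prefix (a + l)) //; last by lia.
have -> : (a + l - s = (a - s) + l)%N by lia.
rewrite expect_split subnKC // -[leRHS](expect_cst s (a - s) c h); exact: le_expect.
Qed.

Lemma expect_prod (G : arr n -> R) a l h :
  expect a l (fun h => \prod_(a <= s < a + l) G (h s.+1)) h = (\sum_x slot_weight x * G x) ^+ l.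
Proof.
elim: l h => [|l IH] h; first by rewrite expr0 /= addn0 big_geq.
rewrite -[in LHS]addn1 expect_split exprSr -(IH h) mulrC -expectZ; apply: eq_expect => h1 /=.
rewrite mulrC big_distrr /=; apply: eq_bigr => x _.
rewrite addnA addn1 big_nat_recr ?leq_addr //= mulrCA; congr (_ * (_ * _)).
  by apply: eq_big_nat => s /andP[_ lt]; rewrite /upd eqSS (ltn_eqF lt).
by rewrite /upd eqxx.
Qed.

Lemma expect_slot (f : arr n -> R) s a l h : (a <= s < a + l)%N ->
  expect a l (fun h => f (h s.+1)) h = \sum_x slot_weight x * f x.
Proof.
move=> /andP[le lt]; have dep : depends_upto s.+1 (fun h : nat -> arr n => f (h s.+1)).
  by move=> h1 h2 E; rewrite E.
rewrite (@expect_prefix s.+1) ?leqW // (_ : s.+1 - a = s - a + 1)%N; last by lia.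
rewrite expect_split subnKC // -[RHS](expect_cst a (s - a) _ h); apply: eq_expect => h' /=.
by apply: eq_bigr => x _; rewrite /upd eqxx.
Qed.

Lemma sum_slot_weight_at ij : \sum_x slot_weight x * (x ij)%:R = p.
Proof.
pose F kl (b : bool) : R := if kl == ij then b%:R else 1.
transitivity (\sum_x slot_weight x * \prod_kl F kl (x kl)).
  apply: eq_bigr => x _; rewrite (bigD1 ij) //= {1}/F eqxx big1 ?mulr1 // => kl ne.
  by rewrite /F (negbTE ne).
rewrite sum_slot_weight_prod (bigD1 ij) //= /F eqxx big1 => [|kl ne]; first by rewrite /=; ring.
by rewrite (negbTE ne); ring.
Qed.

(** * Moments of the number of arrivals in a set of queues *)

Definition count_in (A : {set 'I_n * 'I_n}) (h : nat -> arr n) (a b : nat) : nat :=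
  (\sum_(a <= s < b) \sum_(ij in A) h s.+1 ij)%N.

Lemma expect_count A a l s L h : (s <= a)%N -> (a + l <= s + L)%N ->
  expect s L (fun h => (count_in A h a (a + l))%:R) h = l%:R * #|A|%:R * p.
Proof.
move=> sa le; transitivity (expect s L (fun h =>
    \sum_(a <= t < a + l) \sum_(ij in A) (h t.+1 ij)%:R) h).
  apply: eq_expect; by move=> h'; rewrite /count_in natr_sum; apply: eq_bigr => t _; rewrite natr_sum.
rewrite expect_sum big_nat (eq_bigr (fun=> #|A|%:R * p)) => [|t tr].
  by rewrite -big_nat sumr_const_nat addKn -[LHS]mulr_natl mulrA.
rewrite expect_sum (eq_bigr (fun=> p)) ?sumr_const ?mulr_natl // => ij _.
rewrite (@expect_slot (fun x => (x ij)%:R)) ?sum_slot_weight_at //; lia.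
Qed.

(** Generating function of a binomial variable with l |A| trials: slots and queues factorise, and
    the queues outside [A] contribute a factor 1. *)
Lemma expect_count_pow A u a l h :
  expect a l (fun h => u ^+ count_in A h a (a + l)) h = (1 + p * (u - 1)) ^+ (l * #|A|).
Proof.
pose G (x : arr n) := \prod_ij (if (ij \in A) && x ij then u else 1).
transitivity (expect a l (fun h => \prod_(a <= s < a + l) G (h s.+1)) h).
  apply: eq_expect => h'; rewrite /count_in (big_morph _ (exprD u) (expr0 u)).
  apply: eq_bigr => s _; rewrite (big_morph _ (exprD u) (expr0 u)) big_mkcond /=.
  by apply: eq_bigr => ij _; case: (ij \in A) => //=; case: (h' _ _).
rewrite expect_prod mulnC exprM; congr (_ ^+ _).
rewrite (sum_slot_weight_prod (fun ij b => if (ij \in A) && b then u else 1)).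
rewrite (bigID (mem A)) /= [X in _ * X]big1 => [|ij /negbTE ->]; last by rewrite /=; ring.
rewrite mulr1 (eq_bigr (fun=> 1 + p * (u - 1))) ?prodr_const // => ij /= ->.
by rewrite /=; ring.
Qed.

(** Links the sum over finite histories to the iterated expectation. The induction splits off the
    last slot; the base history is [no_arr] because [ext_hist] pads with it. *)
Lemma expect_histories m phi :
  \sum_(g : {ffun 'I_m -> arr n}) (\prod_(i < m) slot_weight (g i)) * phi (ext_hist g) =
  expect 0 m phi (fun=> no_arr n).
Proof.
elim: m phi => [|m IH] phi.
  rewrite /= (bigD1 [ffun=> no_arr n]) //= big_ord0 mul1r [X in _ + X]big1 ?addr0.
    by congr phi; apply: functional_extensionality => -[|s] //=; case: insubP => // -[].
  by move=> g /eqP[]; apply/ffunP => -[].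
rewrite -[in RHS]addn1 expect_split add0n -IH /=.
pose glue (ga : {ffun 'I_m -> arr n} * arr n) : {ffun 'I_m.+1 -> arr n} :=
  [ffun i => if unlift ord_max i is Some i' then ga.1 i' else ga.2].
pose unglue (g : {ffun 'I_m.+1 -> arr n}) : {ffun 'I_m -> arr n} * arr n :=
  ([ffun i => g (lift ord_max i)], g ord_max).
have glueK : cancel glue unglue.
  move=> [g a]; rewrite /unglue /glue ffunE unlift_none; congr (_, _).
  by apply/ffunP => i; rewrite !ffunE liftK.
have unglueK : cancel unglue glue.
  by move=> g; apply/ffunP => i; rewrite ffunE; case: unliftP => [j|] ->; rewrite ?ffunE.
rewrite (reindex glue) /=; last by apply: onW_bij; exists unglue.
under [RHS]eq_bigr => g _ do rewrite big_distrr /=.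
rewrite [RHS]pair_bigA /=; apply: eq_bigr => -[g a] _ /=.
rewrite [RHS]mulrA big_ord_recr /=; congr (_ * _ * _).
- apply: eq_bigr => i _; rewrite ffunE (_ : widen_ord _ i = lift ord_max i) ?liftK //.
  by apply: val_inj; rewrite /= /bump leqNgt ltn_ord.
- by rewrite ffunE unlift_none.
congr phi; apply: functional_extensionality => -[|s]; rewrite /upd //= eqSS.
(* Slot m + 1 is the glued one; smaller slots are read from [g], and later ones are empty on both
   sides. *)
case: eqP => [->|/eqP ne].
  have lt : (m < m.+1)%N := ltnSn m.
  rewrite (insubT (fun t => t < m.+1)%N lt) /glue ffunE.
  case: unliftP => //= j /(congr1 val) /=; rewrite /bump leqNgt ltn_ord add0n => E.
  by move: (ltn_ord j); rewrite -E ltnn.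
case: insubP => [i|]; rewrite ltnS.
  move=> le E; have lt : (s < m)%N by rewrite ltn_neqAle ne.
  rewrite (insubT (fun t => t < m)%N lt) /= /glue ffunE (_ : i = lift ord_max (Ordinal lt)) ?liftK //.
  by apply: val_inj; rewrite E /= /bump leqNgt lt.
by rewrite -ltnNge => lt; case: insubP => // i lts _; move: (ltn_trans lt lts); rewrite ltnn.
Qed.
End Expectation.

(** * Existence of large factors *)

(** Ore's condition asks for k (s + t - n) edges, and s t / n >= s + t - n because (n - s) (n - t)
    >= 0; cuts with s + t <= n ask for nothing. The mean of a cut is proportional to s t, so this
    form suits a union bound. *)
Lemma ore_of_product n k (M : 'I_n -> 'I_n -> nat) :
  (forall S T : {set 'I_n}, (n < #|S| + #|T| -> k * (#|S| * #|T|) <= cut M S T * n)%N) ->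
  ore k M.
Proof.
move=> H; apply/oreP => S T; have := max_card (mem S); have := max_card (mem T).
rewrite card_ord; have := H S T; move: #|S| #|T| (cut M S T) => s t c.
case: (leqP (s + t)%N n) => [le _ _ _|lt /(_ isT) le tn sn].
  by apply: leq_trans (leq_addl _ _); rewrite leq_mul2l le orbT.
have n0 : (0 < n)%N by lia.
suff : (n * (k * (s + t)) <= n * (c + k * n))%N by rewrite leq_mul2l gtn_eqF.
have : (k * (n * (s + t)) <= k * (s * t + n * n))%N.
  rewrite leq_mul2l; apply/orP; right.
  have [a Ea] : exists a, n = (s + a)%N by exists (n - s)%N; rewrite subnKC.
  have [b Eb] : exists b, n = (t + b)%N by exists (n - t)%N; rewrite subnKC.
  have : (a * (s + a) = a * (t + b))%N by rewrite -Ea -Eb.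
  rewrite Ea; nia.
nia.
Qed.

Lemma cut_arrivals n (h : nat -> arr n) a b (S T : {set 'I_n}) :
  cut (arrivals h a b) S T = count_in (setX S T) h a b.
Proof.
rewrite /cut /count_in pair_big /= [RHS](eq_bigr (fun s =>
  \sum_(ij : 'I_n * 'I_n) h s.+1 ij * ((ij.1 \in S) && (ij.2 \in T)))%N); last first.
  move=> s _; rewrite big_mkcond /=; apply: eq_bigr => -[i j] _; rewrite in_setX /=.
  by case: (_ && _); rewrite ?muln1 ?muln0.
rewrite exchange_big /=; apply: eq_bigr => -[i j] _ /=.
by rewrite /arrivals big_distrl.
Qed.

(** * Exponential inequalities, Chernoff bounds and the probability of a missing factor *)

Section Tails.
Variable R : realType.
Implicit Types x y z : R.

Lemma expRN_le x : 0 <= x -> expR (- x) <= 1 - x + x ^+ 2.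
Proof.
move=> x0; have x2 := expR_ge1Dx (x / 2); have E : expR x = expR (x / 2) ^+ 2.
  by rewrite -expRM_natr; congr expR; field.
rewrite expRN -[leLHS]mul1r ler_pdivrMr ?expR_gt0 // E.
have le : (1 + x / 2) ^+ 2 <= expR (x / 2) ^+ 2 by rewrite lerXn2r ?nnegrE //; lra.
have p0 : 0 <= 1 - x + x ^+ 2 by nra.
apply: le_trans (ler_wpM2l p0 le).
have -> : (1 - x + x ^+ 2) * (1 + x / 2) ^+ 2 = 1 + x ^+ 2 / 4 + 3 / 4 * x ^+ 3 + x ^+ 4 / 4.
  by field.
have := exprn_ge0 2 x0; have := exprn_ge0 3 x0; have := exprn_ge0 4 x0; lra.
Qed.

Lemma expR_le_inv x : x < 1 -> expR x <= (1 - x)^-1.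
Proof.
move=> x1; rewrite -[leLHS]invrK -expRN lef_pV2 ?posrE ?expR_gt0 ?subr_gt0 //.
exact: expR_ge1Dx.
Qed.

Lemma expR_le_quadratic x : 0 <= x -> x <= 1 / 2 -> expR x <= 1 + x + 2 * x ^+ 2.
Proof.
move=> x0 x1; apply: le_trans (expR_le_inv _) _; first by lra.
by rewrite -[leLHS]mul1r ler_pdivrMr; [nra | lra].
Qed.

Lemma expR1_le4 : expR 1 <= 4 :> R.
Proof.
have := @expR_le_inv (1 / 2); have -> : expR 1 = expR (1 / 2) ^+ 2 :> R.
  by rewrite -expRM_natr; congr expR; field.
have -> : (1 - 1 / 2)^-1 = 2 :> R by field.
have := expR_gt0 (1 / 2 : R); nra.
Qed.

Variables (n : nat) (p : R).
Hypothesis (p01 : 0 <= p <= 1).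

Notation expect := (expect p).

(** Exponential Markov inequality, with the threshold hidden in [K]. The sign of [x] is free:
    negative for the lower tail of a cut, nonnegative for the upper tail of a degree. *)
Lemma chernoff A a l h (bad : (nat -> arr n) -> bool) (K x : R) :
  0 <= K -> (forall h, bad h -> 1 <= K * expR x ^+ count_in A h a (a + l)) ->
  expect a l (fun h => (bad h)%:R) h <= K * expR ((l * #|A|)%:R * (p * (expR x - 1))).
Proof.
move=> K0 Hbad.
apply: (@le_trans _ _ (expect a l (fun h => K * expR x ^+ count_in A h a (a + l)) h)).
  apply: le_expect => // h'; case: (boolP (bad h')) => [/Hbad//|_].
  by rewrite mulr_ge0 // exprn_ge0 // expR_ge0.
rewrite expectZ ler_wpM2l // expect_count_pow // expRM_natl lerXn2r ?nnegrE ?expR_ge0 //.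
  case/andP: p01 => p0 p1; have := expR_gt0 x; nra.
exact: expR_ge1Dx.
Qed.

Lemma sum_expr_card (z : R) :
  \sum_(S : {set 'I_n}) z ^+ #|S| = (1 + z) ^+ n.
Proof.
rewrite -[n in RHS]card_ord -prodr_const.
under [RHS]eq_bigr => i _ do rewrite addrC.
rewrite bigA_distr; apply: eq_bigr => S _.
by rewrite -big_mkcond prodr_const.
Qed.

Lemma sum_expr_card_nonempty (z : R) :
  \sum_(S : {set 'I_n} | (0 < #|S|)%N) z ^+ #|S| = (1 + z) ^+ n - 1.
Proof.
rewrite -sum_expr_card [in RHS](bigD1 set0) //= cards0 expr0 [RHS]addrC addKr.
by apply: eq_bigl => S; rewrite card_gt0.
Qed.

Lemma sum_expr_card_compl (z : R) :
  \sum_(T : {set 'I_n}) z ^+ (n - #|T|) = (1 + z) ^+ n.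
Proof.
rewrite -sum_expr_card [RHS](reindex_inj (@setC_inj _)) /=; apply: eq_bigr => T _.
by rewrite -[X in (X - _)%N](card_ord n) -(cardsC T) addKn.
Qed.

(* Union bound over the cuts: with [z = exp (- g / 4)], a cut with sides [s <= t] and
   [s + t > n] fails with probability at most [exp (- g s t / n) <= z ^ (s + (n - t))]. *)
Lemma no_factor_prob k a l h (g x : R) :
  (0 < n)%N -> 0 <= x -> 0 <= g ->
  x * (k%:R - n%:R * p * l%:R) + n%:R * p * l%:R * x ^+ 2 <= - g ->
  n%:R * expR (- (g / 4)) <= 1 / 2 ->
  expect a l (fun h : nat -> arr n => (~~ ore k (arrivals h a (a + l)))%:R) h <=
  8 * (n%:R * expR (- (g / 4))).
Proof.
move=> n0 x0 g0 Hg; set z := expR _ => z2.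
have nR : 0 < n%:R :> R by rewrite ltr0n.
have z0 : 0 < z := expR_gt0 _.
pose cond (ST : {set 'I_n} * {set 'I_n}) := (n < #|ST.1| + #|ST.2|)%N.
pose bad (ST : {set 'I_n} * {set 'I_n}) (h : nat -> arr n) :=
  (cut (arrivals h a (a + l)) ST.1 ST.2 * n < k * (#|ST.1| * #|ST.2|))%N.
(* [b1] majorises the failure of the cuts with no more rows than columns, [b2] that of the others.
   The nonemptiness test removes the constant term of the sum over sets, which leaves a total of
   order n z. *)
pose b1 (ST : {set 'I_n} * {set 'I_n}) : R :=
  if (0 < #|ST.1|)%N then z ^+ #|ST.1| * z ^+ (n - #|ST.2|) else 0.
pose b2 (ST : {set 'I_n} * {set 'I_n}) : R :=
  if (0 < #|ST.2|)%N then z ^+ #|ST.2| * z ^+ (n - #|ST.1|) else 0.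
have b10 ST : 0 <= b1 ST by rewrite /b1; case: ifP => // _; rewrite mulr_ge0 // exprn_ge0 // ltW.
have b20 ST : 0 <= b2 ST by rewrite /b2; case: ifP => // _; rewrite mulr_ge0 // exprn_ge0 // ltW.
have one ST : cond ST -> expect a l (fun h => (bad ST h)%:R) h <= b1 ST + b2 ST.
  case: ST => S T; rewrite /cond /bad /b1 /b2 /= => cST.
  have := max_card (mem S); have := max_card (mem T); rewrite card_ord => tn sn.
  have s0 : (0 < #|S|)%N by rewrite -(ltn_add2r #|T|) add0n; exact: leq_ltn_trans tn cST.
  have t0 : (0 < #|T|)%N by rewrite -(ltn_add2l #|S|) addn0; exact: leq_ltn_trans sn cST.
  rewrite s0 t0.
  (* Threshold and mean are both multiples of [q], namely k q and n p l q, so a single choice of [x]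
     handles all the cuts. *)
  pose q : R := #|S|%:R * #|T|%:R / n%:R.
  have q0 : 0 <= q by rewrite divr_ge0 ?mulr_ge0 ?ler0n.
  apply: (@le_trans _ _ (expR (- (g * q)))).
    apply: le_trans (@chernoff (setX S T) a l h _ (expR (x * (k%:R * q))) (- x) _ _) _.
    - exact: expR_ge0.
    - move=> h'; rewrite cut_arrivals; set N := count_in _ _ _ _ => lt.
      rewrite -expRM_natl -expRD -[leLHS]expR0 ler_expR.
      have : N%:R * n%:R <= k%:R * (#|S|%:R * #|T|%:R) :> R by rewrite -!natrM ler_nat ltnW.
      rewrite -ler_pdivlMr // -mulrA -/q => le.
      by rewrite mulrN (mulrC N%:R) -mulrBr mulr_ge0 // subr_ge0 // mulrA.
    rewrite -expRD ler_expR cardsX !natrM.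
    have E := expRN_le x0.
    have -> : l%:R * (#|S|%:R * #|T|%:R) * (p * (expR (- x) - 1)) =
              q * (n%:R * p * l%:R * (expR (- x) - 1)) :> R.
      by rewrite /q; field; rewrite gt_eqF.
    have m0 : 0 <= n%:R * p * l%:R by case/andP: p01 => *; rewrite !mulr_ge0 ?ler0n.
    have H : x * k%:R + n%:R * p * l%:R * (expR (- x) - 1) <= - g.
      by have := ler_wpM2l m0 E; lra.
    by have := ler_wpM2l q0 H; lra.
  have main s t : (0 < s)%N -> (s <= t)%N -> (t <= n)%N -> (n < s + t)%N ->
      q = s%:R * t%:R / n%:R -> expR (- (g * q)) <= z ^+ s * z ^+ (n - t).
    move=> sp st tn' nst Eq; rewrite -exprD /z -expRM_natl ler_expR.
    (* From s <= t and s + t > n follow t > n / 2 and n - t < s, hence s + (n - t) <= 2 s <= 4 s t /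
       n. *)
    suff H : (s + (n - t))%:R / 4 <= q by have := ler_wpM2l g0 H; lra.
    have h1 : n%:R < s%:R + t%:R :> R by rewrite -natrD ltr_nat.
    have h2 : s%:R <= t%:R :> R by rewrite ler_nat.
    have h3 : t%:R <= n%:R :> R by rewrite ler_nat.
    have h4 : 1 <= s%:R :> R by rewrite ler1n.
    rewrite Eq ler_pdivlMr // natrD natrB //; nra.
  have [st|/ltnW ts] := leqP #|S| #|T|.
    apply: le_trans (main _ _ s0 st tn cST _) _ => //; rewrite lerDl.
    by rewrite mulr_ge0 // exprn_ge0 // ltW.
  apply: le_trans (main _ _ t0 ts sn _ _) _; [by rewrite addnC | by rewrite /q [#|T|%:R * _]mulrC |].
  by rewrite lerDr mulr_ge0 // exprn_ge0 // ltW.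
apply: (@le_trans _ _ (\sum_(ST | cond ST) expect a l (fun h => (bad ST h)%:R) h)).
  rewrite -expect_sum; apply: le_expect => // h'.
  case: (boolP (ore _ _)) => [_|nore] /=; first by apply: sumr_ge0 => ST _; rewrite ler0n.
  have [ST /andP[cST bST]] : exists ST, cond ST && bad ST h'.
    apply/existsP; apply: contraR nore => /existsPn H; apply: ore_of_product => S T lt.
    by have := H (S, T); rewrite /cond /bad /= lt /= -leqNgt.
  by rewrite (bigD1 ST) //= bST lerDl sumr_ge0.
apply: (@le_trans _ _ (\sum_ST (b1 ST + b2 ST))).
  rewrite big_mkcond; apply: ler_sum => ST _; case: ifP => [/one//|_]; exact: addr_ge0.
have zn : (1 + z) ^+ n <= 1 + 2 * (n%:R * z).
  have : (1 + z) ^+ n <= expR (n%:R * z).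
    by rewrite expRM_natl lerXn2r ?nnegrE ?expR_ge0 ?expR_ge1Dx ?addr_ge0 // ltW.
  have y0 : 0 <= n%:R * z by rewrite mulr_ge0 // ltW.
  move=> /le_trans; apply; apply: le_trans (expR_le_quadratic y0 z2) _; nra.
have sb : \sum_ST b1 ST = ((1 + z) ^+ n - 1) * (1 + z) ^+ n.
  rewrite -sum_expr_card_nonempty -sum_expr_card_compl big_distrl [in RHS]big_mkcond /=.
  rewrite [in RHS](eq_bigr (fun S => \sum_T b1 (S, T))); first by rewrite pair_bigA; apply: eq_bigr => -[].
  move=> S _; rewrite /b1 /=; case: ifP => _; last by rewrite big1.
  by rewrite big_distrr.
have sb' : \sum_ST b2 ST = \sum_ST b1 ST.
  have swap_inj : injective (fun ST : {set 'I_n} * {set 'I_n} => (ST.2, ST.1)).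
    by move=> [S T] [S' T'] /= [-> ->].
  by rewrite (reindex_inj swap_inj); apply: eq_bigr => -[S T].
rewrite big_split /= sb' sb.
have y0 : 0 <= n%:R * z by rewrite mulr_ge0 // ltW.
have : 1 <= (1 + z) ^+ n by rewrite exprn_ege1 // lerDl ltW.
move: ((1 + z) ^+ n) (n%:R * z) zn z2 y0 => Y w; nra.
Qed.
End Tails.

(** * The expected queue size of the batching policy *)

Lemma cut_row1 n (M : 'I_n -> 'I_n -> nat) i :
  cut M [set i] setT = (\sum_(j < n) M i j)%N.
Proof.
rewrite /cut (bigD1 i) //= [X in (_ + X)%N]big1 ?addn0 => [|a /negbTE ai].
  by apply: eq_bigr => j _; rewrite !inE eqxx muln1.
by rewrite big1 // => j _; rewrite !inE ai muln0.
Qed.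

Lemma cut_col1 n (M : 'I_n -> 'I_n -> nat) j :
  cut M setT [set j] = (\sum_(i < n) M i j)%N.
Proof. by rewrite -(cut_tr M [set j] setT) cut_row1. Qed.

Lemma total_cut n (M : 'I_n -> 'I_n -> nat) : total M = cut M setT setT.
Proof. by apply: eq_bigr => i _; apply: eq_bigr => j _; rewrite !inE muln1. Qed.

Section Expectation.
Variables (R : realType) (n : nat) (p : R).
Hypothesis (p01 : 0 <= p <= 1).
Notation expect := (expect p).

Lemma expect_pull s l (phi psi : (nat -> arr n) -> R) h : depends_upto s phi ->
  expect s l (fun h => phi h * psi h) h = phi h * expect s l psi h.
Proof.
move=> dep; have : forall s', (s <= s')%N ->
  expect s' l (fun h => phi h * psi h) h = phi h * expect s' l psi h; last exact.
elim: l h => [|l IH] h s' le //=; rewrite big_distrr /=; apply: eq_bigr => x _.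
by rewrite IH ?leqW // (depends_upd _ _ dep) ?ltnS // mulrCA.
Qed.

Lemma expect_total_arrivals a l s L h : (s <= a)%N -> (a + l <= s + L)%N ->
  expect s L (fun h : nat -> arr n => (total (arrivals h a (a + l)))%:R) h =
  l%:R * (n%:R * (n%:R * p)).
Proof.
move=> sa le; transitivity (expect s L (fun h => (count_in (setX [set: 'I_n] setT) h a (a + l))%:R) h).
  by apply: eq_expect => h'; rewrite total_cut cut_arrivals.
by rewrite expect_count // cardsX cardsT card_ord natrM; ring.
Qed.

Lemma degree_tail a l h (D x : R) : 0 <= D -> 0 <= x ->
  expect a l (fun h : nat -> arr n => (D < (degree (arrivals h a (a + l)))%:R)%R%:R) h <=
  2 * n%:R * (expR (- (x * D)) * expR ((l * n)%:R * (p * (expR x - 1)))).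
Proof.
move=> D0 x0; set K := expR (- _) * _.
pose port (c : 'I_n + 'I_n) : {set 'I_n * 'I_n} :=
  match c with inl i => setX [set i] setT | inr j => setX setT [set j] end.
have card_port c : #|port c| = n.
  by case: c => i; rewrite cardsX cards1 cardsT card_ord ?mul1n ?muln1.
apply: (@le_trans _ _ (\sum_c expect a l (fun h : nat -> arr n => (D < (count_in (port c) h a (a + l))%:R)%R%:R) h)).
  rewrite -expect_sum; apply: le_expect => // h'.
  case: ltP => [lt|_]; last by apply: sumr_ge0 => c _; exact: ler0n.
  have [c Hc] : exists c, D < (count_in (port c) h' a (a + l))%:R.
    apply/existsP; apply: contraLR lt => /existsPn H; rewrite -leNgt.
    (* Counts are integers, so the real threshold can be replaced by its truncation and fed to
       [degree_leqP]. *)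
    have {}H c : (count_in (port c) h' a (a + l) <= Num.truncn D)%N.
      by rewrite truncn_ge_nat // leNgt.
    rewrite -truncn_ge_nat //; apply/degree_leqP; split=> i.
      by have := H (inl i); rewrite -cut_arrivals cut_row1.
    by have := H (inr i); rewrite -cut_arrivals cut_col1.
  by rewrite (bigD1 c) //= Hc lerDl sumr_ge0.
have -> : 2 * n%:R * K = \sum_(c : 'I_n + 'I_n) K.
  by rewrite sumr_const card_sum card_ord -[RHS]mulr_natl natrD; ring.
apply: ler_sum => c _; rewrite /K -[X in (l * X)%N](card_port c); apply: chernoff => //.
  exact: expR_ge0.
move=> h' /ltW le; rewrite -expRM_natl -expRD -[leLHS]expR0 ler_expR.
by rewrite addrC subr_ge0 [leRHS]mulrC ler_wpM2l.
Qed.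
End Expectation.

(** * Drift of the overflow and the mean queue size, for abstract failure probabilities *)

Section Batches.
Variables (R : realType) (n d r k : nat) (p p1 p2 D : R).
Hypotheses (p01 : 0 <= p <= 1) (n_gt0 : (0 < n)%N) (d_gt0 : (0 < d)%N) (r_gt0 : (0 < r)%N).
Hypotheses (kd : (k <= d)%N) (rkD : (r * k)%:R <= D) (D_le : D <= (r * d)%:R).
Notation expect := (expect p).
Hypothesis (factor_prob : forall a h,
  expect a d (fun h : nat -> arr n => (~~ ore k (arrivals h a (a + d)))%:R) h <= p1).
Hypothesis (degree_prob : forall a h,
  expect a (r * d) (fun h : nat -> arr n => (D < (degree (arrivals h a (a + r * d)))%:R)%R%:R) h <= p2).

Lemma D_ge0 : 0 <= D.
Proof. exact: le_trans (ler0n _ _) rkD. Qed.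

Definition bad_batch (m : nat) (h : nat -> arr n) : bool :=
  has (fun w => ~~ ore k (window d h w)) (index_iota (m * r) (m * r + r)) ||
  (D < (degree (arrivals h (m * r * d) (m.+1 * r * d)))%:R).

Lemma expect_no_factor w s L h : (s <= w * d)%N -> (w.+1 * d <= s + L)%N ->
  expect s L (fun h : nat -> arr n => (~~ ore k (window d h w))%:R) h <= p1.
Proof.
rewrite mulSnr => sw wL; apply: (@expect_le_window _ _ _ p01 (w * d) d) => //.
  by move=> h1 h2 E; rewrite (@eq_window _ _ h1 h2) // mulSnr.
by move=> h'; rewrite /window mulSnr.
Qed.

Lemma bad_batch_prob m h :
  expect (m * r * d) (r * d) (fun h : nat -> arr n => (bad_batch m h)%:R) h <= r%:R * p1 + p2.
Proof.
have batch_end : (m.+1 * r * d = m * r * d + r * d)%N by rewrite mulSnr mulnDl.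
apply: (@le_trans _ _ (expect (m * r * d) (r * d) (fun h : nat -> arr n =>
  \sum_(m * r <= w < m * r + r) (~~ ore k (window d h w))%:R +
  (D < (degree (arrivals h (m * r * d) (m.+1 * r * d)))%:R)%R%:R) h)).
  apply: le_expect => // h'; rewrite /bad_batch.
  case: hasP => [[w wr nore]|_]; last by rewrite lerDr sumr_ge0.
  rewrite (bigD1_seq w) ?iota_uniq //= nore -addrA lerDl addr_ge0 // sumr_ge0 //.
rewrite expectD expect_sum batch_end; apply: lerD; last exact: degree_prob.
have -> : r%:R * p1 = \sum_(m * r <= w < m * r + r) p1.
  by rewrite sumr_const_nat addKn mulr_natl.
rewrite !big_nat; apply: ler_sum => w /andP[le lt]; apply: expect_no_factor.
  by rewrite leq_mul2r le orbT.
by rewrite -mulnDl leq_mul2r -ltnS ltnS lt orbT.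
Qed.

(** The leftovers have degree at most D - r k and the free slots number r d - r k. The term r k
    cancels, so the overflow drops by r d - D, or to zero, whatever the size of the factors. *)
Lemma overflow_good m h : ~~ bad_batch m h ->
  ((overflow d r k h m.+1)%:R : R) <= Num.max 0 ((overflow d r k h m)%:R - ((r * d)%:R - D)).
Proof.
rewrite negb_or => /andP[/hasPn Hore]; rewrite -leNgt -truncn_ge_nat ?D_ge0 // => degA.
have rkN : (r * k <= Num.truncn D)%N by rewrite truncn_ge_nat ?D_ge0.
have degL : (degree (leftover d r k h m r) + r * k <= Num.truncn D)%N.
  apply: degree_leftover_ore => // w wr; apply/negPn; apply: Hore.
  by rewrite mem_index_iota.
have ND : (Num.truncn D)%:R <= D by rewrite -truncn_ge_nat ?D_ge0.
have := overflowS d r k h m.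
have : (r * (d - k) + r * k = r * d)%N by rewrite -mulnDr subnK.
move: (r * k)%N (r * (d - k))%N (r * d)%N (overflow _ _ _ _ m.+1) (overflow _ _ _ _ m) (degree _) degL.
move=> rk S b V' V L degL <- leV; rewrite le_max -(ler_nat R) in leV *.
case: (leqP (V + L)%N S) => [le|/ltnW le].
  by move: leV; rewrite (eqP le) => ->.
apply/orP; right; apply: le_trans leV _; rewrite natrB //.
have : (L%:R + rk%:R : R) <= D by apply: le_trans ND; rewrite -natrD ler_nat.
rewrite !natrD; lra.
Qed.

Lemma overflow_bad m (h : nat -> arr n) : (overflow d r k h m.+1 <= overflow d r k h m + n * (r * d))%N.
Proof.
apply: leq_trans (overflowS _ _ _ _ _) _; apply: leq_trans (leq_subr _ _) _.
by rewrite leq_add2l degree_leftover.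
Qed.

(** [theta] is the inverse of the largest growth of the overflow over one batch, so a bad batch
    multiplies the exponential by at most e; [v] is the drift of a good batch in the same scale.
    Subtracting 1 makes [potential] vanish when there is no overflow, while it still dominates
    [theta] times the overflow. *)
Let theta : R := ((n * (r * d))%:R)^-1.
Let v : R := theta * ((r * d)%:R - D).
Let potential m (h : nat -> arr n) : R := expR (theta * (overflow d r k h m)%:R) - 1.

Let nb_gt0 : 0 < (n * (r * d))%:R :> R.
Proof. by rewrite ltr0n !muln_gt0 n_gt0 r_gt0. Qed.

Let theta_gt0 : 0 < theta.
Proof. by rewrite invr_gt0. Qed.

Lemma potential_ge0 m h : 0 <= potential m h.
Proof. by rewrite subr_ge0 -[leLHS]expR0 ler_expR mulr_ge0 // ltW. Qed.

(** A good batch contracts by exp (- v). In a bad one the potential P becomes at most e (P + 1) - 1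
    <= 4 P + 3. *)
Lemma potential_step m h :
  potential m.+1 h <= expR (- v) * potential m h + (4 * potential m h + 3) * (bad_batch m h)%:R.
Proof.
have G0 := potential_ge0 m h; have ev := expR_gt0 (- v).
case: (boolP (bad_batch m h)) => [_|/overflow_good].
  have : potential m.+1 h <= 4 * potential m h + 3.
    have le : potential m.+1 h + 1 <= expR 1 * (potential m h + 1).
      rewrite /potential !subrK -expRD ler_expR -[X in X + _](@mulVf _ (n * (r * d))%:R) ?gt_eqF //.
      by rewrite -/theta -mulrDr ler_wpM2l ?(ltW theta_gt0) // addrC -natrD ler_nat overflow_bad.
    have := expR1_le4 R; nra.
  by rewrite mulr1 => /le_trans; apply; rewrite lerDr mulr_ge0 // ltW.
rewrite mulr0 addr0 le_max => /orP[le0|le].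
  apply: (@le_trans _ _ 0); last by rewrite mulr_ge0 // ltW.
  by rewrite subr_le0 -[leRHS]expR0 ler_expR pmulr_rle0.
have := ler_wpM2l (ltW theta_gt0) le; rewrite mulrBr -/v => {}le.
have {}le : expR (theta * (overflow d r k h m.+1)%:R) <=
            expR (- v) * expR (theta * (overflow d r k h m)%:R).
  by rewrite -expRD ler_expR addrC.
have v0 : 0 <= v by rewrite mulr_ge0 ?(ltW theta_gt0) // subr_ge0.
have e1 : expR (- v) <= 1 by rewrite -[leRHS]expR0 ler_expR oppr_le0.
rewrite /potential; lra.
Qed.

Let pbad : R := r%:R * p1 + p2.
Hypothesis (pbad_small : 16 * pbad <= v) (v_small : v <= 1 / 2).

Lemma pbad_ge0 : 0 <= pbad.
Proof.
apply: le_trans (bad_batch_prob 0 (fun=> no_arr n)).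
rewrite -[leLHS](expect_cst p (0 * r * d) (r * d) 0 (fun=> no_arr n)); apply: le_expect => // h.
Qed.

Lemma potential_depends m : depends_upto (m * r * d) (potential m).
Proof. by move=> h h' E; rewrite /potential (eq_overflow _ E). Qed.

(** The smallness of [v] gives exp (- v) <= 1 - v / 2, and 4 [pbad] <= v / 4 absorbs the bad
    batches. The mean potential then obeys Y' <= (1 - v / 4) Y + 3 [pbad], whose fixed point is 12
    [pbad] / v. *)
Lemma expect_potential m h : v * expect 0 (m * r * d) (potential m) h <= 12 * pbad.
Proof.
have P0 := pbad_ge0; elim: m h => [|m IH] h.
  by rewrite !mul0n /= /potential overflow0 // mulr0 expR0 subrr mulr0 mulr_ge0.
have -> : (m.+1 * r * d = m * r * d + r * d)%N by rewrite mulSnr mulnDl.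
have v0 : 0 <= v by apply: le_trans pbad_small; rewrite mulr_ge0.
have ev : expR (- v) <= 1 - v / 2 by apply: le_trans (expRN_le v0) _; move: (v) v0 v_small => w; nra.
have step h' : expect (m * r * d) (r * d) (potential m.+1) h' <=
    (1 - v / 4) * potential m h' + 3 * pbad.
  have G0 := potential_ge0 m h'.
  apply: (@le_trans _ _ (expR (- v) * potential m h' + (4 * potential m h' + 3) * pbad)).
    apply: le_trans (le_expect _ _ _ _ (potential_step m)) _ => //.
    rewrite expectD expectZ (expect_depends _ _ _ (@potential_depends m)) // lerD2l.
    (* The potential is determined by the slots before the batch, so only the conditional
       probability of a bad batch is left to bound. *)
    rewrite expect_pull //; last by move=> h1 h2 E; rewrite (potential_depends E).
    by rewrite ler_wpM2l ?bad_batch_prob // addr_ge0 // mulr_ge0.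
  have A := ler_wpM2r G0 ev; have B := ler_wpM2r G0 pbad_small; lra.
rewrite expect_split add0n; have := IH h; set Y := expect 0 _ _ h => leY.
have : expect 0 (m * r * d) (expect (m * r * d) (r * d) (potential m.+1)) h <=
    (1 - v / 4) * Y + 3 * pbad.
  apply: le_trans (le_expect _ _ _ _ step) _ => //.
  by rewrite expectD expectZ expect_cst.
set Z := expect 0 _ _ h => leZ; apply: le_trans (ler_wpM2l v0 leZ) _.
have w0 : 0 <= 1 - v / 4 by move: (v) v_small => w; lra.
have A := ler_wpM2r w0 leY; lra.
Qed.

Lemma expect_overflow m T h : (m * r * d <= T)%N ->
  v * expect 0 T (fun h : nat -> arr n => (overflow d r k h m)%:R) h <= 12 * pbad * (n * (r * d))%:R.
Proof.
move=> mT; have v0 : 0 <= v by apply: le_trans pbad_small; rewrite mulr_ge0 ?pbad_ge0.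
rewrite (@expect_prefix _ _ _ p01 (m * r * d)) ?subn0 //; last first.
  by move=> h1 h2 E; rewrite (eq_overflow _ E).
apply: le_trans (_ : v * expect 0 (m * r * d) (fun h : nat -> arr n => (n * (r * d))%:R * potential m h) h <= _).
  rewrite ler_wpM2l // le_expect // => h'; rewrite -ler_pdivrMl // -/theta.
  by rewrite lerBrDl expR_ge1Dx.
rewrite expectZ mulrCA mulrC ler_wpM2r ?(ltW nb_gt0) //; exact: expect_potential.
Qed.

Let load : R := d%:R * (n%:R * (n%:R * p)).
Let rest : R := load - n%:R * k%:R + n%:R * k%:R * p1.

(** With a factor, the residual is the window minus n k packets; without one it is at most the whole
    window. Adding n k times the indicator of failure covers both cases by a linear expression, so
    no joint law of arrivals and failure enters. *)
Lemma expect_residual w T h : (w.+1 * d <= T)%N ->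
  expect 0 T (fun h : nat -> arr n => (total (residual k (window d h w)))%:R) h <= rest.
Proof.
rewrite mulSnr => wT; apply: (@expect_le_window _ _ _ p01 (w * d) d) => //.
  by move=> h1 h2 E; rewrite (@eq_window _ _ h1 h2) // mulSnr.
move=> h'; apply: (@le_trans _ _ (expect (w * d) d (fun h : nat -> arr n =>
    ((total (window d h w))%:R + - (n%:R * k%:R)) +
    n%:R * k%:R * (~~ ore k (window d h w))%:R) h')).
  apply: le_expect => // h1; case: (boolP (ore _ _)) => [o|_].
    by rewrite mulr0 addr0 -natrM -(total_residual o) natrD addrK.
  by rewrite mulr1 subrK ler_nat total_residual_le.
rewrite !expectD expectZ expect_cst // /rest; apply: lerD; last first.
  by rewrite ler_wpM2l ?mulr_ge0 // expect_no_factor // mulSnr.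
by rewrite lerD2r /window mulSnr expect_total_arrivals.
Qed.

Lemma rest_ge0 : 0 <= rest.
Proof.
have := @expect_residual 0 (1 * d) (fun=> no_arr n) (leqnn _); apply: le_trans.
rewrite -[leLHS](expect_cst p 0 (1 * d) 0 (fun=> no_arr n)); apply: le_expect => // h.
Qed.

Lemma expect_leftover m l T h : (l <= r)%N -> ((m * r + l) * d <= T)%N ->
  expect 0 T (fun h : nat -> arr n => (total (leftover d r k h m l))%:R) h <= r%:R * rest.
Proof.
move=> lr lT; apply: (@le_trans _ _ (l%:R * rest)); last first.
  by rewrite ler_wpM2r ?rest_ge0 // ler_nat.
rewrite (@eq_expect _ _ _ _ _ _ (fun h : nat -> arr n =>
  \sum_(m * r <= w < m * r + l) (total (residual k (window d h w)))%:R)); last first.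
  by move=> h'; rewrite total_leftover natr_sum.
rewrite expect_sum; have -> : l%:R * rest = \sum_(m * r <= w < m * r + l) rest.
  by rewrite sumr_const_nat addKn mulr_natl.
rewrite !big_nat; apply: ler_sum => w /andP[le lt]; apply: expect_residual.
by apply: leq_trans lT; rewrite leq_mul2r lt orbT.
Qed.

Lemma expect_backlog m T h : (m * r * d <= T)%N ->
  v * expect 0 T (fun h : nat -> arr n => (total (backlog d r k h m))%:R) h <=
  v * (r%:R * rest) + n%:R * (12 * pbad * (n * (r * d))%:R).
Proof.
have P0 := pbad_ge0; have v0 : 0 <= v by apply: le_trans pbad_small; rewrite mulr_ge0.
case: m => [_|m mT].
  rewrite (@eq_expect _ _ _ _ _ _ (fun=> 0)); last first.
    by move=> h'; rewrite /total big1 // => i _; rewrite big1.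
  have R0 := rest_ge0; have e0 : 0 <= n%:R * (12 * pbad * (n * (r * d))%:R) by rewrite !mulr_ge0.
  by rewrite expect_cst mulr0 addr_ge0 // mulr_ge0 // mulr_ge0.
apply: le_trans (_ : v * expect 0 T (fun h : nat -> arr n =>
    n%:R * (overflow d r k h m)%:R + (total (leftover d r k h m r))%:R) h <= _).
  rewrite ler_wpM2l // le_expect // => h'.
  by rewrite -natrM -natrD ler_nat total_backlogS.
rewrite expectD expectZ mulrDr addrC; apply: lerD.
  by rewrite ler_wpM2l // expect_leftover // -mulSnr.
rewrite mulrCA ler_wpM2l // expect_overflow //; apply: leq_trans mT.
by rewrite leq_mul2r leq_mul2r leqnSn !orbT.
Qed.

Lemma expect_total_queue T h :
  v * expect 0 T (fun h : nat -> arr n => (total_queue (batch_policy d r k) h T.+1)%:R) h <=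
  v * (2 * load + 2 * (r%:R * rest)) + n%:R * (12 * pbad * (n * (r * d))%:R).
Proof.
have P0 := pbad_ge0; have v0 : 0 <= v by apply: le_trans pbad_small; rewrite mulr_ge0.
have p0 : 0 <= p by case/andP: p01.
have load0 : 0 <= load by rewrite !mulr_ge0.
have err0 : 0 <= n%:R * (12 * pbad * (n * (r * d))%:R) by rewrite !mulr_ge0.
have R0 := rest_ge0.
have rR0 : 0 <= r%:R * rest by rewrite mulr_ge0.
have load_le l : (l <= d)%N -> l%:R * (n%:R * (n%:R * p)) <= load.
  by move=> ld; rewrite /load ler_wpM2r ?mulr_ge0 // ler_nat.
case: (ltnP T d) => [Td|dT].
  apply: (@le_trans _ _ (v * load)); last by rewrite -[leLHS]addr0 lerD // ler_wpM2l //; lra.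
  rewrite ler_wpM2l //; apply: le_trans (load_le T (ltnW Td)).
  rewrite -(@expect_total_arrivals _ _ _ p01 0 T 0 T h) //; apply: le_expect => // h'.
  by rewrite ler_nat add0n total_queue_start.
pose w := (T %/ d).-1; pose u := (T %% d)%N; pose m := (w %/ r)%N; pose l := (w %% r)%N.
have wE : (w.+1 * d + u = T)%N by rewrite /w prednK ?divn_gt0 // -divn_eq.
have mlE : (m * r + l = w)%N by rewrite -divn_eq.
have lr : (l < r)%N by rewrite ltn_mod.
have ud : (u < d)%N by rewrite ltn_mod.
have wT : (w.+1 * d <= T)%N by rewrite -wE leq_addr.
have wT' : (w * d <= T)%N by apply: leq_trans wT; rewrite leq_mul2r leqnSn orbT.
(* The window awaiting its factor and the arrivals of the current window cost one [load] each; the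
   residuals of the current batch and those inside the backlog cost r [rest] each. *)
apply: le_trans (_ : v * expect 0 T (fun h : nat -> arr n =>
    ((total (arrivals h (w * d) (w * d + d)))%:R + (total (leftover d r k h m l))%:R +
     (total (backlog d r k h m))%:R + (total (arrivals h (w.+1 * d) (w.+1 * d + u)))%:R)) h <= _).
  rewrite ler_wpM2l // le_expect // => h'.
  rewrite -!natrD ler_nat; have := @total_queue_window n d r k d_gt0 r_gt0 kd h' m l u lr.
  by rewrite mlE wE /window -mulSnr.
rewrite !expectD !expect_total_arrivals //; last 2 first.
- by rewrite wE.
- by rewrite -mulSnr.
have A : v * expect 0 T (fun h : nat -> arr n => (total (leftover d r k h m l))%:R) h <=
    v * (r%:R * rest).
  by rewrite ler_wpM2l // expect_leftover ?mlE // ltnW.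
have B : v * expect 0 T (fun h : nat -> arr n => (total (backlog d r k h m))%:R) h <=
    v * (r%:R * rest) + n%:R * (12 * pbad * (n * (r * d))%:R).
  apply: expect_backlog; apply: leq_trans wT'; rewrite leq_mul2r -mlE leq_addr orbT //.
have C := ler_wpM2l v0 (load_le u (ltnW ud)); rewrite -/load.
move: A B C; move: (expect _ _ _ _) (expect _ _ _ _) (u%:R * _) (r%:R * rest) (n%:R * (12 * _ * _)).
move: (v) (load) => v' load' X1 X2 X3 X4 X5; lra.
Qed.
End Batches.

(** * Choice of the parameters *)

Lemma ceil_truncn (R : realType) (x : R) : 0 <= x -> x <= (Num.truncn x).+1%:R <= x + 1.
Proof.
move=> x0; have /andP[le lt] := truncn_itv x0.
by rewrite (ltW lt) /= -natr1 lerD2r.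
Qed.

Lemma ore0 n (M : 'I_n -> 'I_n -> nat) : ore 0 M.
Proof. by apply/oreP => S T; rewrite mul0n. Qed.

(* [y = (1 - rho)^(-1/3)], [exp L = f] and [w = 1 / f]. *)
Section Tuning.
Variables (R : realType) (n : nat) (rho y L : R).
Hypotheses (n_ge2 : (2 <= n)%N) (rho_gt0 : 0 < rho) (rho_lt1 : rho < 1).
Hypotheses (y_ge1 : 1 <= y) (y_cube : y ^+ 3 * (1 - rho) = 1).
Hypotheses (n_le : n%:R <= expR L) (y_le : y ^+ 3 <= expR L).

Let p : R := rho / n%:R.
Let eps : R := 1 - rho.
Let w : R := expR (- L).

Let nR : 2 <= n%:R :> R. Proof. by rewrite ler_nat. Qed.

Let p01 : 0 <= p <= 1.
Proof.
rewrite /p divr_ge0 ?(ltW rho_gt0) ?ler0n //= ler_pdivrMr; last by have := nR; lra.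
by rewrite mul1r; apply: le_trans (ltW rho_lt1) (le_trans _ nR); rewrite ler1n.
Qed.

Let w_gt0 : 0 < w. Proof. exact: expR_gt0. Qed.

Let Fw : expR L * w = 1. Proof. by rewrite /w expRN divff // gt_eqF ?expR_gt0. Qed.

Let nw : n%:R * w <= 1. Proof. by rewrite -[leRHS]Fw ler_wpM2r // ltW. Qed.

Let yw : y ^+ 3 * w <= 1. Proof. by rewrite -[leRHS]Fw ler_wpM2r // ltW. Qed.

Let y_ge0 : 0 <= y. Proof. exact: le_trans ler01 y_ge1. Qed.

Let y2w : y ^+ 2 * w <= 1.
Proof.
apply: le_trans yw; rewrite ler_wpM2r ?(ltW w_gt0) // [leRHS]exprSr ler_peMr //.
by rewrite exprn_ge0.
Qed.

Let w_half : w <= 1 / 2. Proof. have := nw; have := nR; have := w_gt0; nra. Qed.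

Let w_eps : w <= eps.
Proof.
have := yw; have e0 : 0 < eps by rewrite subr_gt0.
move/(ler_wpM2r (ltW e0)); rewrite mul1r mulrAC /eps y_cube mul1r; exact.
Qed.

Let L_half : 1 / 2 <= L.
Proof.
rewrite -ler_expR; apply: le_trans n_le; apply: le_trans nR.
by apply: le_trans (expR_le_inv _) _; [lra | have -> : (1 - 1 / 2)^-1 = 2 :> R by field].
Qed.

(** The successor of a truncation serves as a ceiling and keeps [d] and [r] positive. The batch
    length is at least 320 L y^6 = 320 L / eps^2, and r [sq] is of the order of d. If rho d < 89
    [sq], then k = 0 and whole windows go to the backlog. [D] lies halfway between the mean load b
    (1 - eps) of a port and its capacity b. *)
Let d : nat := (Num.truncn (L * y ^+ 4)).+1.
Let r : nat := (Num.truncn (320 * y ^+ 2)).+1.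
Let sq : R := Num.sqrt (d%:R * L).
Let k : nat := if 89 * sq <= rho * d%:R then Num.truncn (rho * d%:R - 89 * sq) else 0%N.
Let b : nat := (r * d)%N.
Let D : R := b%:R * (1 - eps / 2).
Let p1 : R := 8 * (n%:R * w ^+ 22).
Let p2 : R := 2 * n%:R * w ^+ 10.

Let y2 : 1 <= y ^+ 2. Proof. exact: exprn_ege1. Qed.
Let y4 : 1 <= y ^+ 4. Proof. exact: exprn_ege1. Qed.

Let Ly4 : 1 / 2 <= L * y ^+ 4.
Proof. have := L_half; have := y4; nra. Qed.

Let d_bounds : L * y ^+ 4 <= d%:R <= 3 * (L * y ^+ 4).
Proof.
have x0 : 0 <= L * y ^+ 4 by apply: le_trans Ly4; rewrite divr_ge0.
have /andP[lo hi] := ceil_truncn x0; rewrite lo /=; apply: le_trans hi _.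
have := Ly4; lra.
Qed.

Let r_bounds : 320 * y ^+ 2 <= r%:R <= 321 * y ^+ 2.
Proof.
have x0 : 0 <= 320 * y ^+ 2 by rewrite mulr_ge0 // exprn_ge0.
have /andP[lo hi] := ceil_truncn x0; rewrite lo /=; apply: le_trans hi _.
have := y2; lra.
Qed.

Let d_ge : L * y ^+ 4 <= d%:R. Proof. by case/andP: d_bounds. Qed.
Let d_le : d%:R <= 3 * (L * y ^+ 4). Proof. by case/andP: d_bounds. Qed.
Let r_ge : 320 * y ^+ 2 <= r%:R. Proof. by case/andP: r_bounds. Qed.
Let r_le : r%:R <= 321 * y ^+ 2. Proof. by case/andP: r_bounds. Qed.

Let sq_sqr : sq ^+ 2 = d%:R * L.
Proof. by rewrite sqr_sqrtr // mulr_ge0 ?ler0n //; have := L_half; lra. Qed.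

Let sq_ge0 : 0 <= sq. Proof. exact: sqrtr_ge0. Qed.

Let sq_le : sq <= 2 * (L * y ^+ 2).
Proof.
have L0 := L_half; have y0 := y2.
rewrite -(@ler_pXn2r _ 2) ?nnegrE //; last by rewrite mulr_ge0 // mulr_ge0; lra.
rewrite sq_sqr; have := ler_wpM2r (_ : 0 <= L) d_le; have -> : 0 <= L by lra.
move=> /(_ isT) le; apply: le_trans le _.
have -> : (2 * (L * y ^+ 2)) ^+ 2 = 4 * (L * y ^+ 4) * L by ring.
by rewrite ler_wpM2r //; [lra | have := Ly4; lra].
Qed.

Let k_le : k%:R <= rho * d%:R.
Proof.
rewrite /k; case: ifP => [le|_]; last by rewrite mulr_ge0 // ltW.
have x0 : 0 <= rho * d%:R - 89 * sq by rewrite subr_ge0.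
have /andP[H _] := truncn_itv x0; apply: le_trans H _; have := sq_ge0; lra.
Qed.

Let k_ge : rho * d%:R - k%:R <= 89 * sq + 1.
Proof.
rewrite /k; case: ifP => [le|/negbT]; last by rewrite -ltNge; lra.
have x0 : 0 <= rho * d%:R - 89 * sq by rewrite subr_ge0.
by have /andP[_] := truncn_itv x0; rewrite -natr1; lra.
Qed.

Let kd : (k <= d)%N.
Proof. by rewrite -(ler_nat R); apply: le_trans k_le _; rewrite ler_piMl // ltW. Qed.

(** With x = [sq] / d one has x [sq] = L and rho d x^2 = rho L <= L, so the deficit 89 [sq] of [k]
    yields the exponent g = 88 L; then g / 4 = 22 L is the power of [w] in [p1]. *)
Lemma factor_prob a h :
  expect p a d (fun h : nat -> arr n => (~~ ore k (arrivals h a (a + d)))%:R) h <= p1.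
Proof.
rewrite /k; case: ifP => [le|_]; last first.
  rewrite (@eq_expect _ _ _ _ _ _ (fun=> 0)) => [|h']; last by rewrite ore0.
  by rewrite expect_cst mulr_ge0 // mulr_ge0 // exprn_ge0 // ltW.
have wE : expR (- (88 * L / 4)) = w ^+ 22.
  by rewrite /w -expRM_natl; congr expR; field.
rewrite /p1 -wE; apply: (@no_factor_prob _ _ _ p01 _ _ _ _ (88 * L) (sq / d%:R)).
- exact: leq_trans n_ge2.
- by rewrite divr_ge0.
- by have := L_half; lra.
- have -> : n%:R * p * d%:R = rho * d%:R by rewrite /p; field; rewrite gt_eqF //; have := nR; lra.
  have x0 : 0 <= rho * d%:R - 89 * sq by rewrite subr_ge0.
  have /andP[H _] := truncn_itv x0.
  have E : sq / d%:R * sq = L.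
    by rewrite mulrAC -expr2 sq_sqr mulrAC divff ?mul1r // gt_eqF.
  have E2 : rho * d%:R * (sq / d%:R) ^+ 2 = rho * L.
    by rewrite expr2 -[in RHS]E; field; rewrite gt_eqF.
  rewrite E2; have q0 : 0 <= sq / d%:R by rewrite divr_ge0.
  have L0 : 0 <= L by apply: le_trans L_half; rewrite divr_ge0.
  have rL : rho * L <= L by rewrite ler_piMl // ltW.
  have := ler_wpM2l q0 H; rewrite mulrBr [X in _ <= _ - X]mulrCA E => HX.
  rewrite mulrBr; lra.
- rewrite wE exprS mulrA; have w0 := w_gt0; have wh := w_half.
  have : w ^+ 21 <= (1 / 2) ^+ 1.
    rewrite -[21%N]/(1 + 20)%N exprD; apply: le_trans (_ : _ <= w ^+ 1 * 1) _; last by rewrite mulr1 !expr1.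
    by rewrite ler_wpM2l ?exprn_ge0 ?exprn_ile1 ?(ltW w0) //; lra.
  have w21 : 0 <= w ^+ 21 by rewrite exprn_ge0 // ltW.
  have := nw; rewrite expr1; nra.
Qed.

(** At x = eps / 8, the gap b eps / 2 between [D] and the mean makes the exponent at most - b eps^2
    / 16 + b eps^2 / 32 = - b eps^2 / 32. Since y^6 eps^2 = 1, b eps^2 >= 320 L, whence the power 10
    of [w]. *)
Lemma degree_prob a h :
  expect p a b (fun h : nat -> arr n => (D < (degree (arrivals h a (a + b)))%:R)%R%:R) h <= p2.
Proof.
have e0 : 0 < eps by rewrite subr_gt0.
have e1 : eps < 1 by rewrite /eps ltrBlDr ltrDl.
have b0 : 0 <= b%:R :> R by [].
apply: le_trans (@degree_tail _ _ _ p01 _ _ _ D (eps / 8) _ _) _; [| by lra |].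
  by rewrite mulr_ge0 //; lra.
rewrite /p2 ler_wpM2l ?mulr_ge0 // -expRD /w -expRM_natl ler_expR.
have -> : (b * n)%:R * (p * (expR (eps / 8) - 1)) = b%:R * (rho * (expR (eps / 8) - 1)).
  by rewrite natrM /p; field; rewrite gt_eqF //; have := nR; lra.
have q : expR (eps / 8) <= 1 + eps / 8 + 2 * (eps / 8) ^+ 2 by apply: expR_le_quadratic; lra.
have be : 320 * L <= b%:R * eps ^+ 2.
  rewrite /b natrM; have y6 : y ^+ 2 * y ^+ 4 * eps ^+ 2 = 1.
    by rewrite -exprD (_ : 2 + 4 = 3 * 2)%N // exprM -exprMn y_cube expr1n.
  have : 320 * y ^+ 2 * (L * y ^+ 4) <= r%:R * d%:R.
    by rewrite ler_pM ?r_ge ?d_ge // ?mulr_ge0 //; have := y2; have := L_half; have := y4; lra.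
  move/(ler_wpM2r (exprn_ge0 2 (ltW e0))); apply: le_trans.
  rewrite (_ : _ * eps ^+ 2 = 320 * L * (y ^+ 2 * y ^+ 4 * eps ^+ 2)); last by ring.
  by rewrite y6 mulr1.
have q' := ler_wpM2l (ltW rho_gt0) q.
have q2 := ler_wpM2l b0 q'.
have b3 : 0 <= b%:R * eps ^+ 3 by rewrite mulr_ge0 // exprn_ge0 // ltW.
have rE : rho = 1 - eps by rewrite /eps; ring.
rewrite /D; move: q2 be b3; rewrite rE; lra.
Qed.

Let pbad : R := r%:R * p1 + p2.

Let w_pow j : w ^+ j <= (1 / 2) ^+ j.
Proof. by rewrite lerXn2r ?nnegrE ?divr_ge0 // ltW. Qed.

(** The powers 22 and 10 are large enough for this: r w <= 321 and n w <= 1 cost two factors [w] in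
    [p1], and 8 times 321 is absorbed by w^12 <= 1 / 4096. The remaining w^8 is what the drift
    condition and the final error term consume. *)
Let pbad_le : pbad <= 2 * w ^+ 8.
Proof.
have w0 := ltW w_gt0; have w8 : 0 <= w ^+ 8 by rewrite exprn_ge0.
have A : r%:R * p1 <= w ^+ 8.
  have -> : r%:R * p1 = 8 * (r%:R * w) * (n%:R * w) * w ^+ 12 * w ^+ 8 by rewrite /p1; ring.
  have rw : r%:R * w <= 321.
    apply: le_trans (ler_wpM2r w0 r_le) _; rewrite -mulrA -[leRHS]mulr1 ler_wpM2l //.
  have rw0 : 0 <= r%:R * w by rewrite mulr_ge0.
  have nw0 : 0 <= n%:R * w by rewrite mulr_ge0.
  have c12 : (1 / 2 : R) ^+ 12 = 1 / 4096 by field.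
  have := w_pow 12; rewrite c12 => w12; have w12' : 0 <= w ^+ 12 by rewrite exprn_ge0.
  rewrite ler_piMl //; have rn : r%:R * w * (n%:R * w) <= 321 by have := nw; nra.
  have rn0 : 0 <= r%:R * w * (n%:R * w) by rewrite mulr_ge0.
  rewrite -[8 * _ * _]mulrA; nra.
have B : p2 <= w ^+ 8.
  have -> : p2 = 2 * (n%:R * w) * w * w ^+ 8 by rewrite /p2; ring.
  rewrite ler_piMl //; have := nw; have := w_half; nra.
rewrite /pbad; lra.
Qed.

Let v : R := (n * (r * d))%:R^-1 * ((r * d)%:R - D).

Let n_gt0 : 0 < n%:R :> R. Proof. exact: lt_le_trans nR. Qed.

Let vE : v = eps / (2 * n%:R).
Proof.
by rewrite /v /D /b natrM; field; rewrite !gt_eqF.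
Qed.

Let eps_gt0 : 0 < eps. Proof. by rewrite subr_gt0. Qed.

Let pbad_small : 16 * pbad <= v.
Proof.
rewrite vE ler_pdivlMr ?mulr_gt0 //; apply: le_trans w_eps.
have w0 := ltW w_gt0.
apply: (@le_trans _ _ (64 * (n%:R * w) * w ^+ 6 * w)).
  rewrite (_ : 64 * _ * _ * _ = 16 * (2 * w ^+ 8) * (2 * n%:R)); last by ring.
  by rewrite ler_wpM2r ?ler_wpM2l ?mulr_ge0.
have := w_pow 6; have -> : (1 / 2 : R) ^+ 6 = 1 / 64 by field.
have w6 : 0 <= w ^+ 6 by rewrite exprn_ge0.
move=> le; rewrite ler_piMl //; have := nw; have n0 : 0 <= n%:R * w by rewrite mulr_ge0.
nra.
Qed.

Let v_small : v <= 1 / 2.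
Proof.
rewrite vE ler_pdivrMr ?mulr_gt0 //; have -> : 1 / 2 * (2 * n%:R) = n%:R :> R by field.
apply: le_trans (_ : 1 <= _); last by rewrite ler1n ltnW.
by rewrite /eps lerBlDr lerDl ltW.
Qed.

Let rkD : (r * k)%:R <= D.
Proof.
rewrite /D /b !natrM -mulrA ler_wpM2l //; apply: le_trans k_le _.
rewrite mulrC ler_wpM2l //; have e0 := eps_gt0; have -> : rho = 1 - eps by rewrite /eps; ring.
lra.
Qed.

Let D_le : D <= (r * d)%:R.
Proof. by rewrite /D ler_piMr // lerBlDr lerDl divr_ge0 // ltW. Qed.

Let load : R := d%:R * (n%:R * (n%:R * p)).
Let rest : R := load - n%:R * k%:R + n%:R * k%:R * p1.

(** In units of n L y^4, the two loads cost at most 6, the two remainders at most 2 times 60000,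
    most of it from r (89 [sq] + 1) <= 57780 L y^4, and the overflow at most 24000; the constant
    rounds up the sum. Everything is compared after multiplication by [v] = eps / (2 n). *)
Lemma policy_bound T h :
  expect p 0 T (fun h : nat -> arr n => (total_queue (batch_policy d r k) h T.+1)%:R) h <=
  150 * 1000 * (n%:R * (L * y ^+ 4)).
Proof.
have H := @expect_total_queue R n d r k p p1 p2 D p01 (ltnW n_ge2) (ltn0Sn _) (ltn0Sn _)
  kd rkD D_le factor_prob degree_prob pbad_small v_small T h.
have v0 : 0 < v by rewrite vE divr_gt0 ?mulr_gt0.
rewrite -(ler_pM2l v0); apply: le_trans H _; rewrite -/load -/rest -/pbad -/v.
set B := L * y ^+ 4; have B0 : 1 / 2 <= B := Ly4.
have w0 := ltW w_gt0; have n0 := ltW n_gt0.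
have Bpos : 0 <= B by lra.
have loadE : load = n%:R * (rho * d%:R).
  by rewrite /load /p; field; rewrite gt_eqF.
have load_le : load <= n%:R * (3 * B).
  rewrite loadE ler_wpM2l //; apply: le_trans d_le.
  by rewrite ler_piMl // ltW.
have w8 : 0 <= w ^+ 8 by rewrite exprn_ge0.
have rp0 : 0 <= r%:R * p1 by rewrite mulr_ge0 // mulr_ge0 // mulr_ge0 // exprn_ge0.
have p20 : 0 <= p2 by apply: mulr_ge0; [apply: mulr_ge0 | exact: exprn_ge0].
have rest_le : r%:R * rest <= n%:R * (60 * 1000 * B).
  rewrite (_ : r%:R * rest = n%:R * (r%:R * (rho * d%:R - k%:R) + k%:R * (r%:R * p1))); last first.
    by rewrite /rest loadE; ring.
  rewrite ler_wpM2l //.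
  have y2B : y ^+ 2 <= 2 * B.
    have y20 := exprn_ge0 2 y_ge0; have L0 : 0 <= L by apply: le_trans L_half; rewrite divr_ge0.
    have h1 := ler_wpM2r y20 L_half; have h2 := ler_wpM2l (mulr_ge0 L0 y20) y2.
    by rewrite /B (_ : L * y ^+ 4 = L * y ^+ 2 * y ^+ 2); [lra | ring].
  have A1 : r%:R * (rho * d%:R - k%:R) <= 89 * (642 * B) + 642 * B.
    apply: le_trans (ler_wpM2l (ler0n _ _) k_ge) _.
    rewrite mulrDr mulr1 (mulrCA _ 89); apply: lerD; last first.
      by have := r_le; lra.
    rewrite ler_wpM2l //; apply: le_trans (ler_pM (ler0n _ _) sq_ge0 r_le sq_le) _.
    by rewrite (_ : 321 * _ * _ = 642 * B) // /B; ring.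
  have A2 : k%:R * (r%:R * p1) <= 3 * B.
    have kB : k%:R <= 3 * B.
      by apply: le_trans d_le; rewrite ler_nat.
    have pb1 : r%:R * p1 <= 1.
      have : pbad <= 1.
        apply: le_trans pbad_le _; have := w_pow 8.
        have -> : (1 / 2 : R) ^+ 8 = 1 / 256 by field.
        lra.
      by rewrite /pbad; lra.
    by rewrite -[leRHS]mulr1; apply: ler_pM.
  lra.
have err : n%:R * (12 * pbad * (n * (r * d))%:R) <= v * (n%:R * (24 * 1000 * B)).
  have -> : v * (n%:R * (24 * 1000 * B)) = 12 * (eps * (1000 * B)).
    by rewrite vE; field; rewrite gt_eqF.
  have -> : n%:R * (12 * pbad * (n * (r * d))%:R) = 12 * (n%:R ^+ 2 * pbad * (r%:R * d%:R)).
    by rewrite !natrM; ring.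
  rewrite ler_wpM2l //.
  have rd : r%:R * d%:R <= y ^+ 2 * (1000 * B).
    apply: le_trans (ler_pM (ler0n _ _) (ler0n _ _) r_le d_le) _.
    rewrite -mulrA mulrCA ler_wpM2l ?exprn_ge0 //; rewrite -/B; lra.
  have n2 : 0 <= n%:R ^+ 2 :> R by rewrite exprn_ge0.
  have pb0 : 0 <= pbad by rewrite addr_ge0.
  have np0 : 0 <= n%:R ^+ 2 * pbad by rewrite mulr_ge0.
  apply: le_trans (ler_wpM2l np0 rd) _; rewrite [leLHS]mulrA ler_wpM2r //; first by rewrite mulr_ge0.
  apply: le_trans w_eps; have y20 := exprn_ge0 2 y_ge0.
  apply: le_trans (ler_wpM2r y20 (ler_wpM2l n2 pbad_le)) _.
  rewrite [leLHS](_ : _ = (n%:R * w) ^+ 2 * (y ^+ 2 * w) * (2 * w ^+ 4) * w); last by ring.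
  rewrite ler_piMl //; have w4 := w_pow 4.
  have nw0 : 0 <= n%:R * w by rewrite mulr_ge0.
  have nw2 : (n%:R * w) ^+ 2 <= 1 by rewrite exprn_ile1.
  have y2w0 : 0 <= y ^+ 2 * w by rewrite mulr_ge0.
  have w40 : 0 <= w ^+ 4 by rewrite exprn_ge0.
  have : 2 * w ^+ 4 <= 1.
    move: w4; have -> : (1 / 2 : R) ^+ 4 = 1 / 16 by field.
    lra.
  move=> w41; rewrite mulr_ile1 ?mulr_ge0 ?exprn_ge0 // mulr_ile1 ?exprn_ge0 //.
have E : v * (2 * load + 2 * (r%:R * rest)) <= v * (n%:R * (121 * 1000 * B)).
  rewrite ler_wpM2l ?(ltW v0) //.
  have nB : 0 <= n%:R * B by rewrite mulr_ge0.
  lra.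
have nB : 0 <= v * (n%:R * B) by rewrite mulr_ge0 ?(ltW v0) // mulr_ge0.
lra.
Qed.

Lemma policy_exists : exists pol : policy n, [/\ causal pol, all_feasible pol &
  forall T h, expect p 0 T (fun h : nat -> arr n => (total_queue pol h T.+1)%:R) h <=
    150 * 1000 * (n%:R * (L * y ^+ 4))].
Proof.
exists (batch_policy d r k); split; last exact: policy_bound.
  exact: batch_policy_causal.
exact: batch_policy_feasible.
Qed.
End Tuning.

(** * The theorem *)

(** For n = 1, log f tends to 0 with rho, so the lower bound on [L] used in the tuning fails. A
    single queue that is always served holds no more than the arrivals of the last slot. *)
Definition serve_always : policy 1 := fun _ _ _ _ => true.

Lemma serve_always_feasible : all_feasible serve_always.
Proof. by move=> t h; split=> i; rewrite big_ord1. Qed.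

Lemma qlen_serve_always h t i j : (qlen serve_always h t.+2 i j <= h t.+1 (i, j))%N.
Proof.
elim: t => [|t IH]; first by [].
by rewrite qlenS (eqP (_ : _ - _ == 0)%N) // subn_eq0; exact: leq_trans IH (leq_b1 _).
Qed.

Lemma expect_serve_always (K : realFieldType) (p : K) T h : 0 <= p <= 1 ->
  expect p 0 T (fun h => (total_queue serve_always h T.+1)%:R) h <= p.
Proof.
move=> p01; case: T => [|T].
  by rewrite /= /total_queue big_ord1 big_ord1 /=; case/andP: p01.
apply: (@le_trans _ _ (expect p 0 T.+1 (fun h : nat -> arr 1 => (h T.+1 (ord0, ord0))%:R) h)).
  apply: le_expect => // h'; rewrite ler_nat /total_queue big_ord1 big_ord1.
  exact: qlen_serve_always.
by rewrite (@expect_slot _ _ _ p01 (fun x => (x (ord0, ord0))%:R)) //= sum_slot_weight_at.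
Qed.

(** * The finite sums of the statement as expectations *)

Lemma foldr_Rmult (s : seq R) : foldr Rmult 1%R s = \prod_(x <- s) x.
Proof. by elim: s => [|x s IH]; rewrite ?big_nil // big_cons /= IH. Qed.

Lemma foldr_Rplus (s : seq R) : foldr Rplus 0%R s = \sum_(x <- s) x.
Proof. by elim: s => [|x s IH]; rewrite ?big_nil // big_cons /= IH. Qed.

Lemma hist_probE n m (rho : R) (g : {ffun 'I_m -> arr n}) :
  hist_prob rho g = \prod_(i < m) slot_weight (rho / n%:R) (g i).
Proof.
rewrite /hist_prob foldr_Rmult big_allpairs_dep /= big_enum /=.
apply: eq_bigr => i _; rewrite big_enum /=; apply: eq_big => [ij|ij _]; first by rewrite inE.
by rewrite INRE RdivE.
Qed.

Lemma expected_total_queueE n (rho : R) (pol : policy n) tau :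
  expected_total_queue rho pol tau =
  expect (rho / n%:R) 0 tau.-1 (fun h => (total_queue pol h tau)%:R) (fun=> no_arr n).
Proof.
rewrite -expect_histories /expected_total_queue foldr_Rplus big_map big_enum /=.
apply: eq_big => [g|g _]; first by rewrite inE.
by rewrite hist_probE INRE.
Qed.

(** With the inverse cube root of 1 - rho as variable, all the powers in the tuning are integral and
    its identities are polynomial; the fractional exponent only returns here. *)
Lemma cube_root (K : realType) (x : K) : 0 < x -> x < 1 ->
  let y := expR (- (ln x / 3)) in
  [/\ 1 <= y, y ^+ 3 * x = 1 & y ^+ 4 = expR (- (4 / 3) * ln x)].
Proof.
move=> x0 x1 y; have xE : expR (ln x) = x by rewrite lnK.
have lx : ln x < 0 by rewrite -expR_lt1 xE.
split.
- by rewrite /y -[leLHS]expR0 ler_expR oppr_ge0 pmulr_lle0 ?invr_gt0 // ltW.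
- by rewrite /y -expRM_natl -[X in _ * X]xE -expRD -[RHS]expR0; congr expR; field.
by rewrite /y -expRM_natl; congr expR; field.
Qed.

(** For x = 1 - rho this gives rho <= log f, which absorbs the bound rho on the mean queue of a
    switch with a single queue. *)
Lemma exponent_ge (K : realType) (x L : K) : 0 < x -> 1 / x <= expR L -> 1 - x <= L.
Proof.
move=> x0 le; rewrite -ler_expR; apply: le_trans le; rewrite div1r.
have := expR_ge1Dx (- (1 - x)); rewrite expRN (_ : 1 + - (1 - x) = x); last by ring.
by move=> le; rewrite -[leLHS]invrK lef_pV2 ?posrE ?invr_gt0 ?expR_gt0.
Qed.

Lemma queue_bound (K : realType) (n : nat) (rho : K) : 0 < rho -> rho < 1 ->
  exists pol : policy n, [/\ causal pol, all_feasible pol &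
    forall T h,
      expect (rho / n%:R) 0 T (fun h => (total_queue pol h T.+1)%:R) h <=
      150 * 1000 * (n%:R * (ln (Num.max n%:R (1 / (1 - rho))) * expR (- (ln (1 - rho) / 3)) ^+ 4))].
Proof.
move=> rho0 rho1; have x0 : 0 < 1 - rho by rewrite subr_gt0.
have x1 : 1 - rho < 1 by rewrite ltrBlDr ltrDl.
have [] := cube_root x0 x1; set y := expR _ => y1 y3 _.
set F := Num.max _ _; have F0 : 0 < F by rewrite lt_max divr_gt0 // orbT.
have FE : expR (ln F) = F by rewrite lnK.
have nF : n%:R <= F by rewrite le_max lexx.
have xF : 1 / (1 - rho) <= F by rewrite le_max lexx orbT.
have yF : y ^+ 3 <= F.
  apply: le_trans xF; rewrite ler_pdivlMr // y3 //.
case: n @F F0 FE nF xF yF => [|[|n]] F F0 FE nF xF yF.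
- exists (fun _ _ _ _ => false); split=> //.
    by move=> t h; split=> -[].
  move=> T h; rewrite (@eq_expect _ _ _ _ _ _ (fun=> 0)) => [|h'].
    by rewrite expect_cst mul0r mulr0.
  by rewrite /total_queue big_ord0.
- exists serve_always; split=> //; first exact: serve_always_feasible.
  move=> T h; rewrite divr1; apply: le_trans (expect_serve_always _ _ _) _.
    by rewrite !ltW.
  have rL : rho <= ln F.
    have := @exponent_ge _ (1 - rho) (ln F) x0; rewrite FE => /(_ xF).
    by rewrite opprB addrC subrK.
  rewrite mul1r; have y4 : 1 <= y ^+ 4 by exact: exprn_ege1.
  have lF : 0 <= ln F by apply: le_trans rL; exact: ltW.
  have : ln F <= ln F * y ^+ 4 by rewrite ler_peMr.
  have : 0 <= ln F * y ^+ 4 by rewrite mulr_ge0 // exprn_ge0 // expR_ge0.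
  lra.
have nF' := nF; rewrite -FE in nF'; have yF' := yF; rewrite -FE in yF'.
exact: (@policy_exists K n.+2 rho y (ln F) isT rho0 rho1 y1 y3 nF' yF').
Qed.

Lemma IZR_natr (m : nat) : IZR (Z.of_nat m) = m%:R.
Proof. by rewrite -INR_IZR_INZ INRE. Qed.

Lemma Rpower_cube_root (x : R) : 0 < x -> x < 1 ->
  Rpower x (Ropp (Rdiv (IZR 4) (IZR 3))) = expR (- (ln x / 3)) ^+ 4.
Proof.
move=> x0 x1; have [_ _ ->] := cube_root x0 x1; rewrite /Rpower RexpE RlnE.
by rewrite RmultE RoppE RdivE (IZR_natr 4) (IZR_natr 3).
Qed.

Undelimit Scope ring_scope.
Delimit Scope R_scope with R.
Import Rpower.

Theorem theorem3p1 :
  exists c : R, (0 < c)%R /\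
  forall (n : nat) (rho : R), (0 < rho < 1)%R ->
  exists pol : policy n,
    causal pol /\ all_feasible pol /\
    forall tau : nat, (1 <= tau)%N ->
      (expected_total_queue rho pol tau <=
       c * INR n * Rpower (1 - rho) (- (4 / 3)) *
       ln (Rmax (INR n) (1 / (1 - rho))))%R.
Proof.
exists (INR 150 * INR 1000)%R; split.
  by apply: Rmult_lt_0_compat; apply: lt_0_INR; apply/ssrnat.ltP.
move=> n rho [/RltP rho0 /RltP rho1].
have [pol [caus feas bound]] := queue_bound n rho0 rho1.
exists pol; do 2 split=> //; move=> [|T] // _.
apply/RleP; rewrite expected_total_queueE; apply: le_trans (bound _ _) _.
rewrite Rpower_cube_root; first last.
- by rewrite ltrBlDr ltrDl.
- by rewrite subr_gt0.
rewrite !INRE RlnE RmaxE RdivE !RmultE [leRHS]mulrAC -[leRHS]mulrA -[leRHS]mulrA.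
exact: lexx.
Qed.
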